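(* The morphism of symmetric differential graded operads $\amalg\to\mathrm{Lie}$, where $\mathrm{Lie}$ has zero differential, sending $\langle1,2\rangle$ to the Lie bracket and $[1,2]$ to $0$, is a quasi-isomorphism.
   Context: All operads are symmetric operads in complexes of $\mathbb{Z}$-modules; a morphism is a quasi-isomorphism if it is one in each arity. $\mathrm{Lie}$ is the operad of Lie algebras. Labels in partial compositions are renumbered in the standard way. $\amalg$ is the differential graded operad generated by $[1,2]$, symmetric (i.e. $[1,2]=[2,1]$), of dimension $1$, and $\langle 1,2\rangle$, $\langle 2,1\rangle$ of dimension $0$ (exchanged by the transposition), modulo the ideal generated by the relations \begin{align*} \langle 1,2 \rangle \circ_1 \langle 1,2 \rangle - \tau (\langle 1,2\rangle \circ_1 \langle 2,1 \rangle)+\tau^2 (\langle 2,1 \rangle \circ_1 \langle 2,1 \rangle)&=0,\\ \tau^2 ([1,2]\circ_1 \langle 1,2 \rangle) +\tau ([1,2]\circ_1 \langle2,1 \rangle)&=\langle 1,2 \rangle \circ_1 [1,2],\\ \langle 2,1 \rangle \circ_1 [1,2]&= 0,\\ [1,2]\circ_1 [1,2]+\tau([1,2]\circ_1 [1,2])+\tau^2([1,2]\circ_1 [1,2])&=0, \end{align*} where $\tau$ is the relabelling by the cycle $3\mapsto 2\mapsto 1\mapsto 3$; its differential (lowering dimension by one) is determined by $d([1,2])=\langle 1,2\rangle+\langle 2,1\rangle$ and $d(\langle 1,2\rangle)=0$. *)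

(* Defs.v *)
From HB Require Import structures.
From mathcomp Require Import all_boot all_order all_fingroup all_algebra.
From mathcomp Require Import boolp zify ring.

Set Implicit Arguments.
Unset Strict Implicit.
Unset Printing Implicit Defensive.

Import GRing.Theory.
Local Open Scope ring_scope.
Local Open Scope quotient_scope.

(* Conventions.  Z-modules are zmodTypes, complexes are graded by int and     *)
(* their differentials lower the degree by one.  Inputs are numbered from 0.  *)
(* To avoid casts along arithmetic equalities, an operation whose target has  *)
(* a computed arity or degree takes that arity or degree as a parameter,      *)
(* together with a proof of the defining equation.                            *)

(** * Complexes of Z-modules *)

Record complex := Complex {
  cx_car :> int -> zmodType;
  cx_d : forall p q : int, q + 1 = p -> cx_car p -> cx_car q;
  cx_dD : forall (p q : int) (e : q + 1 = p) (x y : cx_car p),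
    cx_d e (x + y) = cx_d e x + cx_d e y;
  cx_dd : forall (p q r : int) (e : q + 1 = p) (e' : r + 1 = q) (x : cx_car p),
    cx_d e' (cx_d e x) = 0 }.

Definition cycle_at (C : complex) (p : int) (x : C p) : Prop :=
  forall (q : int) (e : q + 1 = p), cx_d e x = 0.

Definition homologous (C : complex) (p : int) (x y : C p) : Prop :=
  exists z : C (p + 1), cx_d erefl z = x - y.

(* For a chain map [f], this says that the map induced on the homology group  *)
(* (cycles modulo boundaries) in each degree is injective and surjective.     *)
Definition quasi_iso (C D : complex) (f : forall p, C p -> D p) : Prop :=
  forall p,
    (forall x y : C p, cycle_at x -> cycle_at y ->
       homologous (f p x) (f p y) -> homologous x y) /\
    (forall y : D p, cycle_at y ->
       exists2 x : C p, cycle_at x & homologous (f p x) y).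

(** * Symmetric operads *)

(* Multiplication by (-1)^p. *)
Definition ksign (V : zmodType) (p : int) (x : V) : V :=
  if odd `|p|%N then - x else x.

(* In x o_i y, with y of arity n, input j of y becomes input i + j and input  *)
(* a != i of x becomes input [outer_label n i a].                             *)
Definition outer_label (n i a : nat) : nat :=
  if (a < i)%N then a else (a + n).-1.

(* [u] is the permutation with (x o_i y)^u = x^s o_(s i) y^t, where x^s is x  *)
(* with input a relabelled as s a.                                            *)
Definition block_perm m n k (i : 'I_m) (s : 'S_m) (t : 'S_n) (u : 'S_k) :=
  (forall (j : 'I_n) (l : 'I_k), l = (i + j)%N :> nat ->
     u l = (s i + t j)%N :> nat) /\
  (forall (a : 'I_m) (l : 'I_k), a != i -> l = outer_label n i a :> nat ->
     u l = outer_label n (s i) (s a) :> nat).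

Lemma block_perm_exists m n k (e : (m + n = k.+1)%N) (i : 'I_m) (s : 'S_m)
  (t : 'S_n) : exists u : 'S_k, block_perm i s t u.
Proof.
pose f (l : 'I_k) : nat :=
  if [pick j : 'I_n | l == (i + j)%N :> nat] is Some j then (s i + t j)%N else
  if [pick a : 'I_m | (a != i) && (l == outer_label n i a :> nat)] is Some a
  then outer_label n (s i) (s a) else 0%N.
have cover (l : 'I_k) : (exists j : 'I_n, l = (i + j)%N :> nat) \/
    (exists2 a : 'I_m, a != i & l = outer_label n i a :> nat).
  have [hl hi] := (ltn_ord l, ltn_ord i).
  have [li|il] := ltnP l i.
    right; exists (Ordinal (ltn_trans li hi)).
      by rewrite -val_eqE /= neq_ltn li.
    by rewrite /outer_label /= li.
  have [lin|inl] := ltnP l (i + n).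
    have hj : (l - i < n)%N by lia.
    by left; exists (Ordinal hj) => /=; lia.
  have ha : ((l - n).+1 < m)%N by lia.
  right; exists (Ordinal ha); first by rewrite -val_eqE /=; lia.
  by rewrite /outer_label /= ifF; lia.
have fin (l : 'I_k) (j : 'I_n) : l = (i + j)%N :> nat -> f l = (s i + t j)%N.
  move=> El; rewrite /f; case: pickP => [j' /eqP El'|/(_ j)]; last by rewrite
      El eqxx.
  by rewrite (_ : j' = j) //; apply: val_inj => /=; lia.
have fout (l : 'I_k) (a : 'I_m) : a != i -> l = outer_label n i a :> nat ->
    f l = outer_label n (s i) (s a).
  rewrite -val_eqE /= => ai El; rewrite /f; case: pickP => [j /eqP|_].
    move=> Elj; exfalso; have hj := ltn_ord j; move: El; rewrite /outer_label.
    by case: ltnP => ?; lia.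
  case: pickP => [a' /andP[]|/(_ a)]; last by rewrite -val_eqE /= ai El eqxx.
  rewrite -val_eqE /= => a'i /eqP; rewrite El => E.
  rewrite (_ : a' = a) //; apply: val_inj => /=; move: E; rewrite /outer_label.
  by case: ltnP => ?; case: ltnP => ?; lia.
have sne a : a != i -> (s a : nat) != s i.
  by move=> ai; rewrite (inj_eq val_inj) (inj_eq perm_inj).
have flt l : (f l < k)%N.
  case: (cover l) => [[j El]|[a ai El]].
    by rewrite (fin _ _ El); have := ltn_ord (s i); have := ltn_ord (t j); lia.
  rewrite (fout _ _ ai El) /outer_label.
  have [ne [hi ha]] := (sne _ ai, (ltn_ord (s i), ltn_ord (s a))).
  by case: (ltnP (s a)) => ?; lia.
have outne (j : 'I_n) a : a != i -> outer_label n (s i) (s a) <> (s i + t j)%N.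
  move=> /sne ne; rewrite /outer_label; have hj := ltn_ord (t j).
  by case: ltnP => ?; lia.
have finj : injective (fun l => Ordinal (flt l)).
  move=> l l' /(congr1 val) /=.
  case: (cover l) => [[j El]|[a ai El]]; case: (cover l') =>
      [[j' El']|[a' a'i El']].
  - rewrite (fin _ _ El) (fin _ _ El') => /addnI /val_inj /perm_inj Ej.
    by apply: val_inj; rewrite /= El El' Ej.
  - by rewrite (fin _ _ El) (fout _ _ a'i El') => /esym /outne; case.
  - by rewrite (fout _ _ ai El) (fin _ _ El') => /outne; case.
  - rewrite (fout _ _ ai El) (fout _ _ a'i El') => E.
    suff /perm_inj Ea : s a = s a' by apply: val_inj; rewrite /= El El' Ea.
    apply: val_inj => /=; have ne := sne _ ai; have ne' := sne _ a'i.
    move: E; rewrite /outer_label.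
    by case: ltnP => ?; case: ltnP => ?; lia.
exists (perm finj); split=> [j l El|a l ai El]; rewrite permE /=.
  exact: fin.
exact: fout.
Qed.

(* Operads in graded Z-modules, with the Koszul sign rule.                    *)
(* [op_act s x] is x with each input a relabelled as s a; as (s * t) a is     *)
(* t (s a) for permutations, this is a right action.                          *)
(* [op_comp e e' i x y] is the partial composition x o_i y.                   *)
Record gradedOperad := GradedOperad {
  op_car :> nat -> int -> zmodType;
  op_id : op_car 1%N 0;
  op_act : forall n p, 'S_n -> op_car n p -> op_car n p;
  op_comp : forall (m n k : nat) (p q r : int),
    (m + n = k.+1)%N -> p + q = r -> 'I_m ->
    op_car m p -> op_car n q -> op_car k r;
  op_actD : forall n p (s : 'S_n) (x y : op_car n p),
    op_act s (x + y) = op_act s x + op_act s y;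
  op_act1 : forall n p (x : op_car n p), op_act 1%g x = x;
  op_actM : forall n p (s t : 'S_n) (x : op_car n p),
    op_act (s * t)%g x = op_act t (op_act s x);
  op_compDl : forall (m n k : nat) (p q r : int) (e : (m + n = k.+1)%N)
      (e' : p + q = r) (i : 'I_m) (x x' : op_car m p) (y : op_car n q),
    op_comp e e' i (x + x') y = op_comp e e' i x y + op_comp e e' i x' y;
  op_compDr : forall (m n k : nat) (p q r : int) (e : (m + n = k.+1)%N)
      (e' : p + q = r) (i : 'I_m) (x : op_car m p) (y y' : op_car n q),
    op_comp e e' i x (y + y') = op_comp e e' i x y + op_comp e e' i x y';
  op_compIl : forall (n : nat) (q : int) (e : (1 + n = n.+1)%N)
      (e' : 0 + q = q) (i : 'I_1) (y : op_car n q),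
    op_comp e e' i op_id y = y;
  op_compIr : forall (m : nat) (p : int) (e : (m + 1 = m.+1)%N)
      (e' : p + 0 = p) (i : 'I_m) (x : op_car m p),
    op_comp e e' i x op_id = x;
  op_comp_seq : forall (l m n k1 k2 k : nat) (p q r t1 t2 t : int)
      (e1 : (l + m = k1.+1)%N) (f1 : p + q = t1)
      (e2 : (k1 + n = k.+1)%N) (f2 : t1 + r = t)
      (e3 : (m + n = k2.+1)%N) (f3 : q + r = t2)
      (e4 : (l + k2 = k.+1)%N) (f4 : p + t2 = t)
      (i : 'I_l) (j : 'I_m) (ij : 'I_k1)
      (x : op_car l p) (y : op_car m q) (z : op_car n r),
    ij = (i + j)%N :> nat ->
    op_comp e2 f2 ij (op_comp e1 f1 i x y) z =
    op_comp e4 f4 i x (op_comp e3 f3 j y z);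
  op_comp_par : forall (l m n k1 k2 k : nat) (p q r t1 t2 t : int)
      (e1 : (l + m = k1.+1)%N) (f1 : p + q = t1)
      (e2 : (k1 + n = k.+1)%N) (f2 : t1 + r = t)
      (e3 : (l + n = k2.+1)%N) (f3 : p + r = t2)
      (e4 : (k2 + m = k.+1)%N) (f4 : t2 + q = t)
      (i j : 'I_l) (j' : 'I_k1) (i' : 'I_k2)
      (x : op_car l p) (y : op_car m q) (z : op_car n r),
    (i < j)%N -> j' = outer_label m i j :> nat ->
    i' = outer_label n j i :> nat ->
    op_comp e2 f2 j' (op_comp e1 f1 i x y) z =
    ksign (q * r) (op_comp e4 f4 i' (op_comp e3 f3 j x z) y);
  op_comp_act : forall (m n k : nat) (p q r : int) (e : (m + n = k.+1)%N)
      (e' : p + q = r) (i : 'I_m) (s : 'S_m) (t : 'S_n) (u : 'S_k)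
      (x : op_car m p) (y : op_car n q),
    block_perm i s t u ->
    op_comp e e' (s i) (op_act s x) (op_act t y) =
    op_act u (op_comp e e' i x y) }.

Arguments op_id : simpl never.
Arguments op_act : simpl never.
Arguments op_comp : simpl never.

Section KsignTheory.
Variable V : zmodType.
Implicit Types (x y : V) (p q : int).

Lemma ksign0 p : ksign p (0 : V) = 0.
Proof. by rewrite /ksign oppr0 if_same. Qed.

Lemma ksignD p x y : ksign p (x + y) = ksign p x + ksign p y.
Proof. by rewrite /ksign; case: ifP; rewrite ?opprD. Qed.

Lemma ksignN p x : ksign p (- x) = - ksign p x.
Proof. by rewrite /ksign; case: ifP. Qed.

Lemma ksignK p x : ksign p (ksign p x) = x.
Proof. by rewrite /ksign; case: odd; rewrite ?opprK. Qed.

Lemma ksignC p q x : ksign p (ksign q x) = ksign q (ksign p x).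
Proof. by rewrite /ksign; case: odd; case: odd. Qed.

Lemma odd_abszD p q : odd `|(p + q)%R|%N = odd `|p|%N (+) odd `|q|%N.
Proof. by lia. Qed.

Lemma ksign_add p q x : ksign (p + q) x = ksign p (ksign q x).
Proof.
rewrite /ksign odd_abszD.
by case: (odd `|p|%N); case: (odd `|q|%N); rewrite /= ?opprK.
Qed.

Lemma ksign_m1 x : ksign (-1) x = - x.
Proof. by []. Qed.

End KsignTheory.

Section GradedOperadTheory.
Variable P : gradedOperad.

Lemma op_act0 n p (s : 'S_n) : op_act s (0 : P n p) = 0.
Proof. by apply: (addrI (op_act s 0)); rewrite -op_actD !addr0. Qed.

Lemma op_actN n p (s : 'S_n) (x : P n p) : op_act s (- x) = - op_act s x.
Proof. by apply: (addrI (op_act s x)); rewrite -op_actD !subrr op_act0. Qed.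

Lemma op_act_ksign n p r (s : 'S_n) (x : P n p) :
  op_act s (ksign r x) = ksign r (op_act s x).
Proof. by rewrite /ksign; case: ifP; rewrite ?op_actN. Qed.

Section Comp.
Variables (m n k : nat) (p q r : int).
Variables (e : (m + n = k.+1)%N) (f : p + q = r) (i : 'I_m).
Implicit Types (x : P m p) (y : P n q).

Lemma op_comp0l y : op_comp e f i 0 y = 0.
Proof. by apply: (addrI (op_comp e f i 0 y)); rewrite -op_compDl !addr0. Qed.

Lemma op_comp0r x : op_comp e f i x 0 = 0.
Proof. by apply: (addrI (op_comp e f i x 0)); rewrite -op_compDr !addr0. Qed.

Lemma op_compNl x y : op_comp e f i (- x) y = - op_comp e f i x y.
Proof.
by apply: (addrI (op_comp e f i x y)); rewrite -op_compDl !subrr op_comp0l.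
Qed.

Lemma op_compNr x y : op_comp e f i x (- y) = - op_comp e f i x y.
Proof.
by apply: (addrI (op_comp e f i x y)); rewrite -op_compDr !subrr op_comp0r.
Qed.

Lemma op_comp_ksignl s x y :
  op_comp e f i (ksign s x) y = ksign s (op_comp e f i x y).
Proof. by rewrite /ksign; case: ifP; rewrite ?op_compNl. Qed.

Lemma op_comp_ksignr s x y :
  op_comp e f i x (ksign s y) = ksign s (op_comp e f i x y).
Proof. by rewrite /ksign; case: ifP; rewrite ?op_compNr. Qed.

End Comp.
End GradedOperadTheory.

Record dgOperad := DgOperad {
  dg_op :> gradedOperad;
  dg_d : forall (n : nat) (p q : int), q + 1 = p -> dg_op n p -> dg_op n q;
  dg_dD : forall (n : nat) (p q : int) (e : q + 1 = p) (x y : dg_op n p),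
    dg_d e (x + y) = dg_d e x + dg_d e y;
  dg_dd : forall (n : nat) (p q r : int) (e : q + 1 = p) (e' : r + 1 = q)
      (x : dg_op n p),
    dg_d e' (dg_d e x) = 0;
  dg_d_id : forall (q : int) (e : q + 1 = 0), dg_d e (op_id dg_op) = 0;
  dg_d_act : forall (n : nat) (p q : int) (e : q + 1 = p) (s : 'S_n)
      (x : dg_op n p),
    dg_d e (op_act s x) = op_act s (dg_d e x);
  dg_d_comp : forall (m n k : nat) (p q r p' q' r' : int) (e : (m + n = k.+1)%N)
      (f : p + q = r) (f1 : p' + q = r') (f2 : p + q' = r')
      (g : p' + 1 = p) (g' : q' + 1 = q) (h : r' + 1 = r)
      (i : 'I_m) (x : dg_op m p) (y : dg_op n q),
    dg_d h (op_comp e f i x y) =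
    op_comp e f1 i (dg_d g x) y + ksign p (op_comp e f2 i x (dg_d g' y)) }.

Definition dg_complex (P : dgOperad) (n : nat) : complex :=
  @Complex (P n) (@dg_d P n) (@dg_dD P n) (@dg_dd P n).

Record dgOperadMorphism (P Q : dgOperad) := DgOperadMorphism {
  mor_fun :> forall n p, P n p -> Q n p;
  morD : forall n p (x y : P n p),
    mor_fun (x + y) = mor_fun x + mor_fun y;
  mor_d : forall (n : nat) (p q : int) (e : q + 1 = p) (x : P n p),
    mor_fun (dg_d e x) = dg_d e (mor_fun x);
  mor_id : mor_fun (op_id P) = op_id Q;
  mor_act : forall n p (s : 'S_n) (x : P n p),
    mor_fun (op_act s x) = op_act s (mor_fun x);
  mor_comp : forall (m n k : nat) (p q r : int) (e : (m + n = k.+1)%N)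
      (f : p + q = r) (i : 'I_m) (x : P m p) (y : P n q),
    mor_fun (op_comp e f i x y) = op_comp e f i (mor_fun x) (mor_fun y) }.

Definition operad_quasi_iso (P Q : dgOperad) (f : dgOperadMorphism P Q) :=
  forall n, @quasi_iso (dg_complex P n) (dg_complex Q n) (f n).

Definition zero_dg (P : gradedOperad) : dgOperad.
Proof.
refine (@DgOperad P (fun _ _ _ _ _ => 0) _ _ _ _ _) => //.
- by move=> *; rewrite addr0.
- by move=> *; rewrite op_act0.
- by move=> *; rewrite op_comp0l op_comp0r ksign0 addr0.
Defined.

(** * Graded operads presented by generators and relations *)

Record signature := Signature {
  gen_sort :> Type;
  gen_arity : gen_sort -> nat;
  gen_degree : gen_sort -> int }.

(* Formal expressions built from the generators with the operations of a      *)
(* graded operad.                                                             *)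
Inductive term (G : signature) : nat -> int -> Type :=
| tgen (g : G) : term G (gen_arity g) (gen_degree g)
| tid : term G 1%N 0
| tzero n p : term G n p
| tadd n p : term G n p -> term G n p -> term G n p
| topp n p : term G n p -> term G n p
| tact n p (s : 'S_n) : term G n p -> term G n p
| tcomp (m n k : nat) (p q r : int) (e : (m + n = k.+1)%N) (f : p + q = r)
    (i : 'I_m) :
    term G m p -> term G n q -> term G k r.
Arguments tgen {G} g.
Arguments tid {G}.
Arguments tzero {G n p}.

Definition tsign (G : signature) n (r p : int) (x : term G n r) : term G n r :=
  if odd `|p|%N then topp x else x.

Definition relations (G : signature) :=
  forall n p, term G n p -> term G n p -> Prop.

(* The least congruence that contains the relations and the axioms of graded  *)
(* operads.  The quotient by it is the free graded operad on [G] modulo the   *)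
(* operadic ideal generated by the relations.                                 *)
Inductive eqv (G : signature) (R : relations G) :
    forall n p, term G n p -> term G n p -> Prop :=
| eqv_rel n p (x y : term G n p) : R n p x y -> eqv R x y
| eqv_refl n p (x : term G n p) : eqv R x x
| eqv_sym n p (x y : term G n p) : eqv R x y -> eqv R y x
| eqv_trans n p (x y z : term G n p) : eqv R x y -> eqv R y z -> eqv R x z
| eqv_add n p (x x' y y' : term G n p) :
    eqv R x x' -> eqv R y y' -> eqv R (tadd x y) (tadd x' y')
| eqv_opp n p (x x' : term G n p) : eqv R x x' -> eqv R (topp x) (topp x')
| eqv_act n p (s : 'S_n) (x x' : term G n p) :
    eqv R x x' -> eqv R (tact s x) (tact s x')
| eqv_comp (m n k : nat) (p q r : int) (e : (m + n = k.+1)%N) (f : p + q = r)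
      (i : 'I_m) (x x' : term G m p) (y y' : term G n q) :
    eqv R x x' -> eqv R y y' -> eqv R (tcomp e f i x y) (tcomp e f i x' y')
| eqv_addA n p (x y z : term G n p) :
    eqv R (tadd x (tadd y z)) (tadd (tadd x y) z)
| eqv_addC n p (x y : term G n p) : eqv R (tadd x y) (tadd y x)
| eqv_add0 n p (x : term G n p) : eqv R (tadd tzero x) x
| eqv_addN n p (x : term G n p) : eqv R (tadd (topp x) x) tzero
| eqv_actD n p (s : 'S_n) (x y : term G n p) :
    eqv R (tact s (tadd x y)) (tadd (tact s x) (tact s y))
| eqv_act1 n p (x : term G n p) : eqv R (tact 1%g x) x
| eqv_actM n p (s t : 'S_n) (x : term G n p) :
    eqv R (tact (s * t)%g x) (tact t (tact s x))
| eqv_compDl (m n k : nat) (p q r : int) (e : (m + n = k.+1)%N) (f : p + q = r)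
      (i : 'I_m) (x x' : term G m p) (y : term G n q) :
    eqv R (tcomp e f i (tadd x x') y)
        (tadd (tcomp e f i x y) (tcomp e f i x' y))
| eqv_compDr (m n k : nat) (p q r : int) (e : (m + n = k.+1)%N) (f : p + q = r)
      (i : 'I_m) (x : term G m p) (y y' : term G n q) :
    eqv R (tcomp e f i x (tadd y y'))
        (tadd (tcomp e f i x y) (tcomp e f i x y'))
| eqv_compIl (n : nat) (q : int) (e : (1 + n = n.+1)%N) (f : 0 + q = q)
      (i : 'I_1) (y : term G n q) :
    eqv R (tcomp e f i tid y) y
| eqv_compIr (m : nat) (p : int) (e : (m + 1 = m.+1)%N) (f : p + 0 = p)
      (i : 'I_m) (x : term G m p) :
    eqv R (tcomp e f i x tid) x
| eqv_comp_seq (l m n k1 k2 k : nat) (p q r t1 t2 t : int)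
      (e1 : (l + m = k1.+1)%N) (f1 : p + q = t1)
      (e2 : (k1 + n = k.+1)%N) (f2 : t1 + r = t)
      (e3 : (m + n = k2.+1)%N) (f3 : q + r = t2)
      (e4 : (l + k2 = k.+1)%N) (f4 : p + t2 = t)
      (i : 'I_l) (j : 'I_m) (ij : 'I_k1)
      (x : term G l p) (y : term G m q) (z : term G n r) :
    ij = (i + j)%N :> nat ->
    eqv R (tcomp e2 f2 ij (tcomp e1 f1 i x y) z)
          (tcomp e4 f4 i x (tcomp e3 f3 j y z))
| eqv_comp_par (l m n k1 k2 k : nat) (p q r t1 t2 t : int)
      (e1 : (l + m = k1.+1)%N) (f1 : p + q = t1)
      (e2 : (k1 + n = k.+1)%N) (f2 : t1 + r = t)
      (e3 : (l + n = k2.+1)%N) (f3 : p + r = t2)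
      (e4 : (k2 + m = k.+1)%N) (f4 : t2 + q = t)
      (i j : 'I_l) (j' : 'I_k1) (i' : 'I_k2)
      (x : term G l p) (y : term G m q) (z : term G n r) :
    (i < j)%N -> j' = outer_label m i j :> nat ->
    i' = outer_label n j i :> nat ->
    eqv R (tcomp e2 f2 j' (tcomp e1 f1 i x y) z)
          (tsign (q * r) (tcomp e4 f4 i' (tcomp e3 f3 j x z) y))
| eqv_comp_act (m n k : nat) (p q r : int) (e : (m + n = k.+1)%N)
      (f : p + q = r) (i : 'I_m) (s : 'S_m) (t : 'S_n) (u : 'S_k)
      (x : term G m p) (y : term G n q) :
    block_perm i s t u ->
    eqv R (tcomp e f (s i) (tact s x) (tact t y)) (tact u (tcomp e f i x y)).

HB.instance Definition _ (G : signature) n p := gen_eqMixin (term G n p).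
HB.instance Definition _ (G : signature) n p := gen_choiceMixin (term G n p).

Local Notation repr := generic_quotient.repr.

Section Presented.
Variables (G : signature) (R : relations G).

Definition eqvb n p (x y : term G n p) : bool := `[< eqv R x y >].

Lemma eqvb_class n p : equiv_class_of (@eqvb n p).
Proof.
split.
- by move=> x; apply/asboolP; apply: eqv_refl.
- by move=> x y; apply/asboolP/asboolP; apply: eqv_sym.
- move=> y x z /asboolP xy /asboolP yz; apply/asboolP; exact: eqv_trans xy yz.
Qed.

Canonical eqv_equiv n p := EquivRelPack (@eqvb_class n p).

Definition pcar n p := {eq_quot (eqv_equiv n p)}.

HB.instance Definition _ n p := Choice.on (pcar n p).

Definition pcl n p (x : term G n p) : pcar n p := \pi_(pcar n p) x.

Lemma pclP n p (x y : term G n p) : pcl x = pcl y <-> eqv R x y.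
Proof.
split; first by move/eqmodP/asboolP.
by move=> xy; apply/eqmodP/asboolP.
Qed.

Lemma repr_eqv n p (x : term G n p) : eqv R (repr (pcl x)) x.
Proof. by apply/pclP; rewrite /pcl reprK. Qed.

Lemma pcl_repr n p (x : pcar n p) : pcl (repr x) = x.
Proof. exact: reprK. Qed.

Definition padd n p (x y : pcar n p) := pcl (tadd (repr x) (repr y)).
Definition popp n p (x : pcar n p) := pcl (topp (repr x)).
Definition pact n p (s : 'S_n) (x : pcar n p) := pcl (tact s (repr x)).
Definition pcomp m n k p q r (e : (m + n = k.+1)%N) (f : p + q = r) (i : 'I_m)
  (x : pcar m p) (y : pcar n q) := pcl (tcomp e f i (repr x) (repr y)).

Lemma paddE n p (x y : term G n p) : padd (pcl x) (pcl y) = pcl (tadd x y).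
Proof. by apply/pclP; apply: eqv_add; apply: repr_eqv. Qed.
Lemma poppE n p (x : term G n p) : popp (pcl x) = pcl (topp x).
Proof. by apply/pclP; apply: eqv_opp; apply: repr_eqv. Qed.
Lemma pactE n p s (x : term G n p) : pact s (pcl x) = pcl (tact s x).
Proof. by apply/pclP; apply: eqv_act; apply: repr_eqv. Qed.
Lemma pcompE (m n k : nat) (p q r : int) (e : (m + n = k.+1)%N) (f : p + q = r)
    i
    (x : term G m p) (y : term G n q) :
  pcomp e f i (pcl x) (pcl y) = pcl (tcomp e f i x y).
Proof. by apply/pclP; apply: eqv_comp; apply: repr_eqv. Qed.

Lemma pcar_ind n p (P : pcar n p -> Prop) : (forall x, P (pcl x)) -> forall x,
    P x.
Proof. by move=> H x; rewrite -(pcl_repr x). Qed.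

Fact paddA n p : associative (@padd n p).
Proof.
elim/pcar_ind=> x; elim/pcar_ind=> y; elim/pcar_ind=> z.
by rewrite !paddE; apply/pclP/eqv_addA.
Qed.
Fact paddC n p : commutative (@padd n p).
Proof.
by elim/pcar_ind=> x; elim/pcar_ind=> y; rewrite !paddE; apply/pclP/eqv_addC.
Qed.
Fact padd0 n p : left_id (pcl tzero) (@padd n p).
Proof. by elim/pcar_ind=> x; rewrite paddE; apply/pclP/eqv_add0. Qed.
Fact paddN n p : left_inverse (pcl tzero) (@popp n p) (@padd n p).
Proof. by elim/pcar_ind=> x; rewrite poppE paddE; apply/pclP/eqv_addN. Qed.

HB.instance Definition _ n p := GRing.isZmodule.Build (pcar n p)
  (@paddA n p) (@paddC n p) (@padd0 n p) (@paddN n p).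

Lemma pclD n p (x y : term G n p) : pcl (tadd x y) = pcl x + pcl y.
Proof. by rewrite -paddE. Qed.
Lemma pclN n p (x : term G n p) : pcl (topp x) = - pcl x.
Proof. by rewrite -poppE. Qed.
Lemma pcl_sign n r p (x : term G n r) : pcl (tsign p x) = ksign p (pcl x).
Proof. by rewrite /tsign /ksign; case: ifP; rewrite ?pclN. Qed.

Definition presented : gradedOperad.
Proof.
refine (@GradedOperad (fun n p => pcar n p : zmodType) (pcl tid) pact pcomp
  _ _ _ _ _ _ _ _ _ _).
- move=> n p s; elim/pcar_ind=> x; elim/pcar_ind=> y.
  by rewrite -pclD !pactE -pclD; apply/pclP/eqv_actD.
- by move=> n p; elim/pcar_ind=> x; rewrite pactE; apply/pclP/eqv_act1.
- by move=> n p s t; elim/pcar_ind=> x; rewrite !pactE; apply/pclP/eqv_actM.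
- move=> m n k p q r e f i.
  elim/pcar_ind=> x; elim/pcar_ind=> x'; elim/pcar_ind=> y.
  by rewrite -pclD !pcompE -pclD; apply/pclP/eqv_compDl.
- move=> m n k p q r e f i.
  elim/pcar_ind=> x; elim/pcar_ind=> y; elim/pcar_ind=> y'.
  by rewrite -pclD !pcompE -pclD; apply/pclP/eqv_compDr.
- by move=> n q e f i; elim/pcar_ind=> y; rewrite pcompE; apply/pclP/eqv_compIl.
- by move=> n q e f i; elim/pcar_ind=> y; rewrite pcompE; apply/pclP/eqv_compIr.
- move=> l m n k1 k2 k p q r t1 t2 t e1 f1 e2 f2 e3 f3 e4 f4 i j ij.
  elim/pcar_ind=> x; elim/pcar_ind=> y; elim/pcar_ind=> z Hij.
  by rewrite !pcompE; apply/pclP/eqv_comp_seq.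
- move=> l m n k1 k2 k p q r t1 t2 t e1 f1 e2 f2 e3 f3 e4 f4 i j j' i'.
  elim/pcar_ind=> x; elim/pcar_ind=> y; elim/pcar_ind=> z ltij Hj Hi.
  by rewrite !pcompE -pcl_sign; apply/pclP/eqv_comp_par.
- move=> m n k p q r e f i s t u.
  elim/pcar_ind=> x; elim/pcar_ind=> y Hu.
  by rewrite (pcompE e f i x y) !pactE pcompE; apply/pclP/eqv_comp_act.
Defined.

Definition cls n p (x : term G n p) : presented n p := pcl x.

(** ** The derivation with prescribed values on the generators *)

Lemma pred_degree (p : int) : p - 1 + 1 = p.
Proof. exact: subrK. Qed.

Lemma degree_pred (p q : int) : q + 1 = p -> p - 1 = q.
Proof. by move=> <-; rewrite addrK. Qed.

Lemma degree_predl (p q r r' : int) : p + q = r -> r' + 1 = r -> p - 1 + q = r'.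
Proof. by move=> <- e; apply: (addIr 1); rewrite e addrAC subrK. Qed.

Lemma degree_predr (p q r r' : int) : p + q = r -> r' + 1 = r -> p + (q - 1) =
    r'.
Proof. by move=> <- e; apply: (addIr 1); rewrite e addrA subrK. Qed.

Variable dgen : forall g : G, presented (gen_arity g) (gen_degree g - 1).

Fixpoint der n p (x : term G n p) {struct x} :
    forall q : int, q + 1 = p -> presented n q :=
  match x in term _ n p return forall q : int, q + 1 = p -> presented n q with
  | tgen g => fun q e =>
      ecast q' (presented (gen_arity g) q') (degree_pred e) (dgen g)
  | tid => fun q e => 0
  | tzero n p => fun q e => 0
  | tadd n p x y => fun q e => der x e + der y e
  | topp n p x => fun q e => - der x e
  | tact n p s x => fun q e => op_act s (der x e)
  | tcomp m n k p q r e f i x y => fun r' h =>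
      op_comp e (degree_predl f h) i (der x (pred_degree p)) (cls y) +
      ksign p (op_comp e (degree_predr f h) i (cls x) (der y (pred_degree q)))
  end.

Lemma der_irr n p (x : term G n p) (q : int) (e e' : q + 1 = p) : der x e = der
    x e'.
Proof. by rewrite (eq_irrelevance e e'). Qed.

Lemma der_comp (m n k : nat) (p q r p' q' r' : int) (e : (m + n = k.+1)%N)
    (f : p + q = r) (f1 : p' + q = r') (f2 : p + q' = r')
    (g : p' + 1 = p) (g' : q' + 1 = q) (h : r' + 1 = r)
    (i : 'I_m) (x : term G m p) (y : term G n q) :
  der (tcomp e f i x y) h =
  op_comp e f1 i (der x g) (cls y) +
  ksign p (op_comp e f2 i (cls x) (der y g')).
Proof.
have Ep := degree_pred g; have Eq := degree_pred g'; subst p' q' => /=.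
rewrite (eq_irrelevance (degree_predl f h) f1) (der_irr x _ g).
by rewrite (eq_irrelevance (degree_predr f h) f2) (der_irr y _ g').
Qed.

Lemma clsD n p (x y : term G n p) : cls (tadd x y) = cls x + cls y.
Proof. exact: pclD. Qed.

Lemma clsN n p (x : term G n p) : cls (topp x) = - cls x.
Proof. exact: pclN. Qed.

Lemma cls0 n p : cls (@tzero G n p) = 0.
Proof. by []. Qed.

Lemma cls_sign n r p (x : term G n r) : cls (tsign p x) = ksign p (cls x).
Proof. exact: pcl_sign. Qed.

Lemma cls_act n p s (x : term G n p) : cls (tact s x) = op_act s (cls x).
Proof. by rewrite /cls -pactE. Qed.

Lemma cls_comp (m n k : nat) (p q r : int) (e : (m + n = k.+1)%N)
    (f : p + q = r) i
    (x : term G m p) (y : term G n q) :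
  cls (tcomp e f i x y) = op_comp e f i (cls x) (cls y).
Proof. by rewrite /cls -pcompE. Qed.

Lemma cls_id : cls tid = op_id presented.
Proof. by []. Qed.

Lemma clsP n p (x y : term G n p) : cls x = cls y <-> eqv R x y.
Proof. exact: pclP. Qed.

Lemma der_sign n r p (x : term G n r) (q : int) (e : q + 1 = r) :
  der (tsign p x) e = ksign p (der x e).
Proof. by rewrite /tsign /ksign; case: ifP. Qed.

Hypothesis der_rel : forall n p (x y : term G n p), R x y ->
  forall (q : int) (e : q + 1 = p), der x e = der y e.

Lemma der_eqv n p (x y : term G n p) : eqv R x y ->
  forall (q : int) (e : q + 1 = p), der x e = der y e.
Proof.
elim=> {n p x y}.
- exact: der_rel.
- by [].
- by move=> n p x y _ IH q e; rewrite IH.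
- by move=> n p x y z _ IH1 _ IH2 q e; rewrite IH1 IH2.
- by move=> n p x x' y y' _ IH1 _ IH2 q e /=; rewrite IH1 IH2.
- by move=> n p x x' _ IH q e /=; rewrite IH.
- by move=> n p s x x' _ IH q e /=; rewrite IH.
- move=> m n k p q r e f i x x' y y' xx' IHx yy' IHy r' h /=.
  by rewrite (IHx _ (pred_degree p)) (IHy _ (pred_degree q));
    move/clsP: xx' => ->; move/clsP: yy' => ->.
- by move=> n p x y z q e /=; rewrite addrA.
- by move=> n p x y q e /=; rewrite addrC.
- by move=> n p x q e /=; rewrite add0r.
- by move=> n p x q e /=; rewrite addNr.
- by move=> n p s x y q e /=; rewrite op_actD.
- by move=> n p x q e /=; rewrite op_act1.
- by move=> n p s t x q e /=; rewrite op_actM.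
- move=> m n k p q r e f i x x' y r' h /=.
  by rewrite clsD !op_compDl ksignD addrACA.
- move=> m n k p q r e f i x y y' r' h /=.
  by rewrite clsD !op_compDr ksignD addrACA.
- move=> n q e f i y r' h; have Er := degree_pred h; subst r'.
  have f1 : 0 - 1 + q = q - 1 by lia.
  have f2 : 0 + (q - 1) = q - 1 by lia.
  rewrite (der_comp e f f1 f2 (pred_degree 0) h h) /=.
  by rewrite op_comp0l add0r cls_id op_compIl.
- move=> m p e f i x r' h; have Er := degree_pred h; subst r'.
  have f1 : p - 1 + 0 = p - 1 by lia.
  have f2 : p + (0 - 1) = p - 1 by lia.
  rewrite (der_comp e f f1 f2 h (pred_degree 0) h) /=.
  by rewrite op_comp0r ksign0 addr0 cls_id op_compIr.
- move=> l m n k1 k2 k p q r t1 t2 t e1 f1 e2 f2 e3 f3 e4 f4 i j ij x y z Hij.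
  move=> t' h; have Et := degree_pred h.
  have h1 := pred_degree p; have h2 := pred_degree q; have h3 := pred_degree r.
  have g1 := pred_degree t1; have g2 := pred_degree t2.
  have a1 : p - 1 + q = t1 - 1 by lia.
  have a2 : p + (q - 1) = t1 - 1 by lia.
  have a3 : q - 1 + r = t2 - 1 by lia.
  have a4 : q + (r - 1) = t2 - 1 by lia.
  have b1 : t1 - 1 + r = t' by lia.
  have b2 : t1 + (r - 1) = t' by lia.
  have b3 : p - 1 + t2 = t' by lia.
  have b4 : p + (t2 - 1) = t' by lia.
  rewrite (der_comp e2 f2 b1 b2 g1 h3 h) (der_comp e1 f1 a1 a2 h1 h2 g1).
  rewrite (der_comp e4 f4 b3 b4 h1 g2 h) (der_comp e3 f3 a3 a4 h2 h3 g2).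
  rewrite !cls_comp op_compDl op_compDr op_comp_ksignl op_comp_ksignr.
  rewrite (op_comp_seq e1 a1 e2 b1 e3 f3 e4 b3 _ _ _ Hij).
  rewrite (op_comp_seq e1 a2 e2 b1 e3 a3 e4 b4 _ _ _ Hij).
  rewrite (op_comp_seq e1 f1 e2 b2 e3 a4 e4 b4 _ _ _ Hij).
  by rewrite ksignD -f1 ksign_add addrA.
- move=> l m n k1 k2 k p q r t1 t2 t e1 f1 e2 f2 e3 f3 e4 f4 i j j' i' x y z.
  move=> ltij Hj Hi t' h; have Et := degree_pred h.
  have h1 := pred_degree p; have h2 := pred_degree q; have h3 := pred_degree r.
  have g1 := pred_degree t1; have g2 := pred_degree t2.
  have a1 : p - 1 + q = t1 - 1 by lia.
  have a2 : p + (q - 1) = t1 - 1 by lia.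
  have a3 : p - 1 + r = t2 - 1 by lia.
  have a4 : p + (r - 1) = t2 - 1 by lia.
  have b1 : t1 - 1 + r = t' by lia.
  have b2 : t1 + (r - 1) = t' by lia.
  have b3 : t2 - 1 + q = t' by lia.
  have b4 : t2 + (q - 1) = t' by lia.
  rewrite der_sign.
  rewrite (der_comp e2 f2 b1 b2 g1 h3 h) (der_comp e1 f1 a1 a2 h1 h2 g1).
  rewrite (der_comp e4 f4 b3 b4 g2 h2 h) (der_comp e3 f3 a3 a4 h1 h3 g2).
  rewrite !cls_comp !op_compDl !op_comp_ksignl.
  rewrite (op_comp_par e1 a1 e2 b1 e3 a3 e4 b3 _ _ _ ltij Hj Hi).
  rewrite (op_comp_par e1 a2 e2 b1 e3 f3 e4 b4 _ _ _ ltij Hj Hi).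
  rewrite (op_comp_par e1 f1 e2 b2 e3 a4 e4 b3 _ _ _ ltij Hj Hi).
  rewrite !ksignD -!addrA; congr (_ + _); rewrite addrC; congr (_ + _).
    by rewrite -!ksign_add -f1; congr (ksign _ _); ring.
  rewrite -!ksign_add.
  have -> : q * r + t2 = r + (r + (p + (q - 1) * r)) by rewrite -f3; ring.
  by rewrite !(ksign_add r) ksignK.
- move=> m n k p q r e f i s t u x y Hu r' h.
  have Er := degree_pred h.
  have h1 := pred_degree p; have h2 := pred_degree q.
  have f1 : p - 1 + q = r' by lia.
  have f2 : p + (q - 1) = r' by lia.
  rewrite -[RHS]/(op_act u (der (tcomp e f i x y) h)).
  rewrite !(der_comp e f f1 f2 h1 h2 h) /=.
  by rewrite !cls_act !(op_comp_act _ _ _ _ Hu) op_actD op_act_ksign.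
Qed.

Definition pder n (p q : int) (e : q + 1 = p) (x : presented n p) :
  presented n q := der (repr x) e.

Lemma pderE n (p q : int) (e : q + 1 = p) (x : term G n p) :
  pder e (cls x) = der x e.
Proof. by apply: der_eqv; apply: repr_eqv. Qed.

Lemma cls_ind n p (P : presented n p -> Prop) :
  (forall x, P (cls x)) -> forall x, P x.
Proof. exact: pcar_ind. Qed.

Lemma pderD n (p q : int) (e : q + 1 = p) (x y : presented n p) :
  pder e (x + y) = pder e x + pder e y.
Proof.
by elim/cls_ind: x => x; elim/cls_ind: y => y; rewrite -clsD !pderE.
Qed.

Lemma pder0 n (p q : int) (e : q + 1 = p) : pder e (0 : presented n p) = 0.
Proof. by apply: (addrI (pder e 0)); rewrite -pderD !addr0. Qed.

Lemma pderN n (p q : int) (e : q + 1 = p) (x : presented n p) :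
  pder e (- x) = - pder e x.
Proof. by apply: (addrI (pder e x)); rewrite -pderD !subrr pder0. Qed.

Lemma pder_sign n (r p q : int) (e : q + 1 = p) (x : presented n p) :
  pder e (ksign r x) = ksign r (pder e x).
Proof. by rewrite /ksign; case: ifP; rewrite ?pderN. Qed.

Lemma pder_act n (p q : int) (e : q + 1 = p) (s : 'S_n) (x : presented n p) :
  pder e (op_act s x) = op_act s (pder e x).
Proof. by elim/cls_ind: x => x; rewrite -cls_act !pderE. Qed.

Lemma pder_comp (m n k : nat) (p q r p' q' r' : int) (e : (m + n = k.+1)%N)
    (f : p + q = r) (f1 : p' + q = r') (f2 : p + q' = r')
    (g : p' + 1 = p) (g' : q' + 1 = q) (h : r' + 1 = r)
    (i : 'I_m) (x : presented m p) (y : presented n q) :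
  pder h (op_comp e f i x y) =
  op_comp e f1 i (pder g x) y + ksign p (op_comp e f2 i x (pder g' y)).
Proof.
elim/cls_ind: x => x; elim/cls_ind: y => y.
by rewrite -cls_comp !pderE (der_comp e f f1 f2 g g' h).
Qed.

Hypothesis dgen_cycle : forall (g : G) (q : int) (e : q + 1 = gen_degree g - 1),
  pder e (dgen g) = 0.

Lemma pder_pder n (p q r : int) (e : q + 1 = p) (e' : r + 1 = q)
  (x : presented n p) : pder e' (pder e x) = 0.
Proof.
elim/cls_ind: x => x; rewrite pderE.
elim: x q r e e' => {n p}.
- move=> g q r e e' /=; move: (degree_pred e) e' => Eq; clear e.
  by case: q / Eq => e'; rewrite dgen_cycle.
- by move=> q r e e'; rewrite pder0.
- by move=> n p q r e e'; rewrite pder0.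
- by move=> n p x IHx y IHy q r e e' /=; rewrite pderD IHx IHy addr0.
- by move=> n p x IHx q r e e' /=; rewrite pderN IHx oppr0.
- by move=> n p s x IHx q r e e' /=; rewrite pder_act IHx op_act0.
- move=> m n k p q t e f i x IHx y IHy t1 t2 h h'.
  have a1 := pred_degree p; have a2 := pred_degree (p - 1).
  have b1 := pred_degree q; have b2 := pred_degree (q - 1).
  have c1 : p - 1 + q = t1 by lia.
  have c2 : p + (q - 1) = t1 by lia.
  have c3 : p - 1 - 1 + q = t2 by lia.
  have c4 : p - 1 + (q - 1) = t2 by lia.
  have c5 : p + (q - 1 - 1) = t2 by lia.
  rewrite (der_comp e f c1 c2 a1 b1 h) pderD pder_sign.
  rewrite (pder_comp e c1 c3 c4 a2 b1 h') (pder_comp e c2 c4 c5 a1 b2 h').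
  rewrite pderE IHx IHy op_comp0l op_comp0r ksign0 add0r addr0 pderE.
  by rewrite ksign_add ksignC ksign_m1 addNr.
Qed.

Definition presented_dg : dgOperad.
Proof.
refine (@DgOperad presented pder pderD pder_pder _ pder_act pder_comp).
by move=> q e; rewrite -cls_id pderE.
Defined.

End Presented.

(** * The operads of the statement *)

Declare Scope operad_term_scope.
Delimit Scope operad_term_scope with OT.
Notation "0" := tzero : operad_term_scope.
Notation "x + y" := (tadd x y) : operad_term_scope.
Notation "- x" := (topp x) : operad_term_scope.
Notation "x - y" := (tadd x (topp y)) : operad_term_scope.

(* x o_1 y for binary x and y; the first input is number 0 here. *)
Definition tcomp1 (G : signature) (p q : int)
    (x : term G 2%N p) (y : term G 2%N q) : term G 3%N (p + q) :=
  @tcomp G 2 2 3 p q (p + q) erefl erefl ord0 x y.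
Notation "x 'o_1' y" := (tcomp1 x y) (at level 40, left associativity) :
  operad_term_scope.

Definition transp : 'S_2 := tperm ord0 ord_max.

(* The cycle 3 |-> 2 |-> 1 |-> 3 with labels shifted to 0, 1, 2: [ord_pred]   *)
(* is the predecessor modulo 3.                                               *)
Definition cycle3 : 'S_3 := perm (@ord_pred_inj 3).

Definition tau (G : signature) (p : int) (x : term G 3%N p) : term G 3%N p :=
  tact cycle3 x.

(** ** The operad of Lie algebras *)

Inductive lie_gen := Bracket.
Definition lie_sig := @Signature lie_gen (fun _ => 2%N) (fun _ => 0).
Definition bracket : term lie_sig 2%N 0 := @tgen lie_sig Bracket.

Inductive lie_rel : relations lie_sig :=
| lie_anti : lie_rel (tact transp bracket) (- bracket)%OT
| lie_jacobi : let J := (bracket o_1 bracket)%OT in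
    lie_rel (J + tau J + tau (tau J))%OT 0%OT.

Definition Lie : dgOperad := zero_dg (presented lie_rel).
Definition lie_bracket : Lie 2%N 0 := cls lie_rel bracket.

(** ** The operad amalg *)

Inductive amalg_gen := Angle | Square.
Definition amalg_degree (g : amalg_gen) : int :=
  match g with Angle => 0 | Square => 1 end.
Definition amalg_sig := @Signature amalg_gen (fun _ => 2%N) amalg_degree.

Definition ang12 : term amalg_sig 2%N 0 := @tgen amalg_sig Angle.
Definition ang21 : term amalg_sig 2%N 0 := tact transp ang12.
Definition sq12 : term amalg_sig 2%N 1 := @tgen amalg_sig Square.

Inductive amalg_rel : relations amalg_sig :=
| amalg_sym : amalg_rel (tact transp sq12) sq12
| amalg_leibniz :
    amalg_rel (ang12 o_1 ang12 - tau (ang12 o_1 ang21)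
               + tau (tau (ang21 o_1 ang21)))%OT 0%OT
| amalg_deriv :
    amalg_rel (tau (tau (sq12 o_1 ang12)) + tau (sq12 o_1 ang21))%OT
              (ang12 o_1 sq12)%OT
| amalg_right :
    amalg_rel (ang21 o_1 sq12)%OT 0%OT
| amalg_jacobi :
    amalg_rel (sq12 o_1 sq12 + tau (sq12 o_1 sq12)
               + tau (tau (sq12 o_1 sq12)))%OT 0%OT.

(* [amalg_degree Square - 1] reduces to 0. *)
Definition amalg_dgen (g : amalg_sig) :
    presented amalg_rel (gen_arity g) (gen_degree g - 1) :=
  match g with
  | Angle => 0
  | Square => cls amalg_rel (ang12 + ang21)%OT
  end.

Local Notation acls := (cls amalg_rel).
Local Notation ader := (der amalg_dgen).

Lemma der_ang12 (q : int) (e : q + 1 = 0) : ader ang12 e = 0.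
Proof.
by rewrite /=; move: (degree_pred e) => Eq; clear e; case: q / Eq.
Qed.

Lemma der_ang21 (q : int) (e : q + 1 = 0) : ader ang21 e = 0.
Proof. by rewrite -[LHS]/(op_act transp (ader ang12 e)) der_ang12 op_act0. Qed.

Lemma der_sq12 (e : 0 + 1 = 1 :> int) : ader sq12 e = acls ang12 + acls ang21.
Proof.
rewrite -clsD -[LHS]/(ecast q' (presented amalg_rel 2%N q') (degree_pred e)
  (acls (ang12 + ang21)%OT)).
by rewrite (eq_irrelevance (degree_pred e) erefl).
Qed.

Section AmalgDer.
Let P := presented amalg_rel.
Let a : P 2%N 0 := acls ang12.
Let b : P 2%N 1 := acls sq12.
Let o1 : 'I_3 := @Ordinal 3 1 isT.
Let o2 : 'I_3 := @Ordinal 3 2 isT.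
Let rho : 'S_3 := tperm ord0 o1.

Lemma perm_ext3 (s t : 'S_3) :
  s ord0 = t ord0 -> s o1 = t o1 -> s o2 = t o2 -> s = t.
Proof.
move=> h0 h1 h2; apply/permP => -[[|[|[|//]]] hi].
- by rewrite [Ordinal hi](_ : _ = ord0) //; apply: val_inj.
- by rewrite [Ordinal hi](_ : _ = o1) //; apply: val_inj.
- by rewrite [Ordinal hi](_ : _ = o2) //; apply: val_inj.
Qed.

Lemma rho0 : rho ord0 = o1. Proof. by rewrite tpermL. Qed.
Lemma rho1 : rho o1 = ord0. Proof. by rewrite tpermR. Qed.
Lemma rho2 : rho o2 = o2. Proof. by rewrite tpermD. Qed.
Lemma cycle3_0 : cycle3 ord0 = o2.
Proof. by rewrite permE; apply: val_inj. Qed.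
Lemma cycle3_1 : cycle3 o1 = ord0.
Proof. by rewrite permE; apply: val_inj. Qed.
Lemma cycle3_2 : cycle3 o2 = o1.
Proof. by rewrite permE; apply: val_inj. Qed.

Let permS3 := (permM, rho0, rho1, rho2, cycle3_0, cycle3_1, cycle3_2, perm1).

Lemma rhoK : (rho * rho = 1)%g.
Proof. by apply: perm_ext3; rewrite !permS3. Qed.
Lemma cycle3K : (cycle3 * (cycle3 * cycle3) = 1)%g.
Proof. by apply: perm_ext3; rewrite !permS3. Qed.
Lemma rho_cycle3 : (cycle3 * rho = rho * (cycle3 * cycle3))%g.
Proof. by apply: perm_ext3; rewrite !permS3. Qed.

Lemma block_rho : block_perm (ord0 : 'I_2) 1%g transp rho.
Proof.
split.
- move=> [[|[|//]] hj] l /= El; rewrite perm1.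
    have -> : Ordinal hj = ord0 by apply: val_inj.
    have -> : l = ord0 by apply: val_inj.
    by rewrite rho0 tpermL.
  have -> : Ordinal hj = ord_max by apply: val_inj.
  have -> : l = o1 by apply: val_inj.
  by rewrite rho1 tpermR.
- move=> [[|[|//]] ha] l //= _ El; rewrite !perm1.
  have -> : l = o2 by apply: val_inj.
  by rewrite rho2.
Qed.

(* x o_1 y^(12) is the relabelling of x o_1 y by (12). *)
Lemma comp1_transp (p q r : int) (e : (2 + 2 = 4)%N) (f : p + q = r)
    (x : P 2%N p) (y : P 2%N q) :
  op_comp e f ord0 x (op_act transp y) = op_act rho (op_comp e f ord0 x y).
Proof.
have := op_comp_act e f x y block_rho.
by rewrite op_act1 perm1.
Qed.

Lemma act_rr (p : int) (x : P 3%N p) : op_act rho (op_act rho x) = x.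
Proof. by rewrite -op_actM rhoK op_act1. Qed.

Lemma act_ccc (p : int) (x : P 3%N p) :
  op_act cycle3 (op_act cycle3 (op_act cycle3 x)) = x.
Proof. by rewrite -!op_actM cycle3K op_act1. Qed.

Lemma act_rc (p : int) (x : P 3%N p) :
  op_act rho (op_act cycle3 x) = op_act cycle3 (op_act cycle3 (op_act rho x)).
Proof. by rewrite -!op_actM rho_cycle3. Qed.

Let actE := (act_rr, act_rc, act_ccc).
Local Notation "''r' x" := (op_act rho x) (at level 8, x at level 8).
Local Notation "''c' x" := (op_act cycle3 x) (at level 8, x at level 8).

Lemma amalg_rel_cls n (p : int) (x y : term amalg_sig n p) :
  amalg_rel x y -> acls x = acls y.
Proof. by move=> xy; apply/clsP; apply: eqv_rel. Qed.

Let c (p q r : int) (f : p + q = r) (x : P 2%N p) (y : P 2%N q) : P 3%N r :=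
  op_comp (erefl : (2 + 2 = 4)%N) f ord0 x y.

Let A : P 3%N 0 := c (erefl : 0 + 0 = 0 :> int) a a.
Let B : P 3%N 0 := c (erefl : 0 + 0 = 0 :> int) (op_act transp a) a.
Let E : P 3%N 1 := c (erefl : 1 + 0 = 1 :> int) b a.

Lemma leibniz_cls : A - 'c ('r A) + 'c ('c ('r B)) = 0.
Proof.
have := amalg_rel_cls amalg_leibniz.
by rewrite /tau /tcomp1 !clsD clsN !cls_act !cls_comp !cls_act !comp1_transp.
Qed.

Lemma deriv_cls : 'c ('c E) + 'c ('r E) = c (erefl : 0 + 1 = 1 :> int) a b.
Proof.
have := amalg_rel_cls amalg_deriv.
by rewrite /tau /tcomp1 !clsD !cls_act !cls_comp !cls_act !comp1_transp.
Qed.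

Lemma right_cls : c (erefl : 0 + 1 = 1 :> int) (op_act transp a) b = 0.
Proof.
have := amalg_rel_cls amalg_right.
by rewrite /tcomp1 !cls_comp !cls_act.
Qed.

Lemma right_B : 'r B = - B.
Proof.
have L := leibniz_cls.
have := congr1 (fun x => 'c ('r x)) L.
rewrite !(op_actD, op_actN, op_act0) !actE => L'.
have : (A - 'c ('r A) + 'c ('c ('r B))) + ('c ('r A) - A + 'c ('c B)) = 0.
  by rewrite L L' addr0.
rewrite addrACA -opprB addNr add0r => /(congr1 (op_act cycle3)).
by rewrite op_actD op_act0 !actE => /eqP; rewrite addr_eq0 => /eqP.
Qed.

Lemma left_A : 'c ('r A) + 'c ('c B) = A.
Proof.
have := leibniz_cls; rewrite right_B !op_actN => /eqP.
by rewrite subr_eq0 subr_eq => /eqP L; rewrite [RHS]L addrC.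
Qed.

Lemma left_rA : 'c ('c A) + 'c ('r B) = 'r A.
Proof.
by rewrite -[in RHS]left_A op_actD !actE right_B.
Qed.

Lemma degreeN1 (q q' : int) : q + 1 = q' -> q = q' - 1.
Proof. by move=> <-; rewrite addrK. Qed.

Lemma der_c (x y : term amalg_sig 2%N 0) (q : int) (e : q + 1 = 0) :
  (forall (q' : int) (e' : q' + 1 = 0), ader x e' = 0) ->
  (forall (q' : int) (e' : q' + 1 = 0), ader y e' = 0) ->
  ader (x o_1 y)%OT e = 0.
Proof.
move=> dx dy; have Eq := degreeN1 e; subst q.
rewrite (der_comp _ _ _ (erefl : 0 - 1 + 0 = 0 - 1 :> int)
  (erefl : 0 + (0 - 1) = 0 - 1 :> int) (erefl : 0 - 1 + 1 = 0 :> int) erefl).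
by rewrite dx dy op_comp0l op_comp0r ksign0 addr0.
Qed.

Lemma der_tau (p q : int) (x : term amalg_sig 3%N p) (e : q + 1 = p) :
  ader (tau x) e = 'c (ader x e).
Proof. by []. Qed.

Lemma der_add (p q : int) (x y : term amalg_sig 3%N p) (e : q + 1 = p) :
  ader (x + y)%OT e = ader x e + ader y e.
Proof. by []. Qed.

Lemma der_opp (p q : int) (x : term amalg_sig 3%N p) (e : q + 1 = p) :
  ader (- x)%OT e = - ader x e.
Proof. by []. Qed.

Lemma der_sq_ (y : term amalg_sig 2%N 0) (e : 0 + 1 = 1 :> int) :
  (forall (q' : int) (e' : q' + 1 = 0), ader y e' = 0) ->
  ader (sq12 o_1 y)%OT e =
  c (erefl : 0 + 0 = 0 :> int) (a + op_act transp a) (acls y).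
Proof.
move=> dy.
rewrite (der_comp _ _ _ (erefl : 0 + 0 = 0 :> int)
  (erefl : 1 + (0 - 1) = 0 :> int) (erefl : 0 + 1 = 1 :> int)
  (erefl : 0 - 1 + 1 = 0 :> int)).
by rewrite dy op_comp0r ksign0 addr0 der_sq12 -cls_act.
Qed.

Lemma der_sq_r (x : term amalg_sig 2%N 0) (e : 0 + 1 = 1 :> int) :
  (forall (q' : int) (e' : q' + 1 = 0), ader x e' = 0) ->
  ader (x o_1 sq12)%OT e =
  c (erefl : 0 + 0 = 0 :> int) (acls x) (a + op_act transp a).
Proof.
move=> dx.
rewrite (der_comp _ _ _ (erefl : 0 - 1 + 1 = 0 :> int)
  (erefl : 0 + 0 = 0 :> int) (erefl : 0 - 1 + 1 = 0 :> int)
  (erefl : 0 + 1 = 1 :> int)).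
by rewrite dx op_comp0l add0r der_sq12 -cls_act.
Qed.

Lemma der_sq_sq (e : 1 + 1 = 2 :> int) :
  ader (sq12 o_1 sq12)%OT e = ('c ('c E) + 'c ('r E)) - (E + 'r E).
Proof.
rewrite (der_comp _ _ _ (erefl : 0 + 1 = 1 :> int)
  (erefl : 1 + 0 = 1 :> int) (erefl : 0 + 1 = 1 :> int)
  (erefl : 0 + 1 = 1 :> int)).
rewrite der_sq12 /ksign /= cls_act op_compDl op_compDr comp1_transp.
transitivity (c (erefl : 0 + 1 = 1 :> int) a b +
  c (erefl : 0 + 1 = 1 :> int) (op_act transp a) b - (E + 'r E)) => //.
by rewrite right_cls addr0 deriv_cls.
Qed.

Lemma cancel12 (V : zmodType) (x0 x1 x2 y0 y1 y2 : V) :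
  (x2 + y1 - (x0 + y0)) + (x0 + y2 - (x1 + y1)) + (x1 + y0 - (x2 + y2)) = 0.
Proof.
rewrite !opprD !addrA.
rewrite [LHS](ACl ((1*11)*(2*8)*(3*5)*(4*10)*(6*12)*(7*9))) /=.
by rewrite !subrr !addNr !addr0.
Qed.

Lemma amalg_der_rel n (p : int) (x y : term amalg_sig n p) : amalg_rel x y ->
  forall (q : int) (e : q + 1 = p), ader x e = ader y e.
Proof.
case=> {n p x y} q e; have Eq := degreeN1 e; subst q.
- rewrite -[LHS]/(op_act transp (ader sq12 e)) der_sq12 cls_act op_actD.
  by rewrite -op_actM tperm2 op_act1; exact: addrC.
- rewrite !der_add der_opp !der_tau.
  have d0 (X : zmodType) : 0 - 0 + 0 = 0 :> X by rewrite subrr addr0.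
  by rewrite !der_c ?op_act0 ?d0 //; try exact: der_ang12; exact: der_ang21.
- rewrite !der_add !der_tau !der_sq_; last first.
  + exact: der_ang12.
  + exact: der_ang21.
  rewrite der_sq_r; last exact: der_ang12.
  have -> : c (erefl : 0 + 0 = 0 :> int) (acls ang12) (a + op_act transp a) =
      A + 'r A.
    by rewrite /c op_compDr comp1_transp.
  have -> : c (erefl : 0 + 0 = 0 :> int) (a + op_act transp a) (acls ang12) =
      A + B.
    by rewrite /c op_compDl. 
  have -> : c (erefl : 0 + 0 = 0 :> int) (a + op_act transp a) (acls ang21) =
      'r (A + B).
    by rewrite cls_act /c comp1_transp op_compDl.
  have -> : A + 'r A = ('c ('r A) + 'c ('c B)) + ('c ('c A) + 'c ('r B)).
    by rewrite left_A left_rA.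
  by rewrite !op_actD addrACA [RHS]addrACA; congr (_ + _); rewrite addrC.
- rewrite der_sq_r; last exact: der_ang21.
  rewrite cls_act /c op_compDr comp1_transp -/(c _ _ _) -/B right_B.
  exact: subrr.
- rewrite !der_add !der_tau !der_sq_sq.
  by rewrite !(op_actD, op_actN) !actE cancel12.
Qed.

Lemma amalg_dgen_cycle (g : amalg_sig) (q : int)
    (e : q + 1 = gen_degree g - 1) :
  pder amalg_dgen e (amalg_dgen g) = 0.
Proof.
case: g e => e; first by rewrite /= (pder0 amalg_der_rel).
by rewrite (pderE amalg_der_rel) /= -[LHS]/(ader ang12 e + ader ang21 e)
  der_ang12 der_ang21 addr0.
Qed.

End AmalgDer.

Definition Amalg : dgOperad := presented_dg amalg_der_rel amalg_dgen_cycle.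

Definition amalg_angle : Amalg 2%N 0 := cls amalg_rel ang12.
Definition amalg_square : Amalg 2%N 1 := cls amalg_rel sq12.

Lemma amalg_d_angle (q : int) (e : q + 1 = 0) : dg_d e amalg_angle = 0.
Proof. by rewrite -[LHS]/(pder _ _ _) (pderE amalg_der_rel) der_ang12. Qed.

Lemma amalg_d_square (e : 0 + 1 = 1 :> int) :
  dg_d e amalg_square = amalg_angle + op_act transp amalg_angle.
Proof.
by rewrite -[LHS]/(pder _ _ _) (pderE amalg_der_rel) der_sq12 cls_act.
Qed.

(* Main.v *)
Require Import Defs.
From mathcomp Require Import all_boot all_order all_fingroup all_algebra.
From mathcomp Require Import zify ring.

Set Implicit Arguments.
Unset Strict Implicit.
Unset Printing Implicit Defensive.

Import GRing.Theory.
Local Open Scope ring_scope.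

(** Write <x,y> and [x,y] for the two operations, select one input, the mark,
and consider the operators A_c = <-,c>, R_c = [-,c] and L_c = <c,-> that add a
new input c to an operation in which the mark occurs.  The relations read
<<x,y>,z> = <<x,z>,y> + <x,<y,z>>, <[x,y],z> = [x,<y,z>] + [<x,z>,y],
<x,[y,z]> = 0, together with the symmetry and the Jacobi identity of [-,-].

Existence.  The relations express A and R for a composite argument by A and R
for its inputs.  So an operation of positive arity is reached from the mark by
the operators A_c, R_c and L_c; in arity 0 there are none but 0.  Since
d[x,c] = <x,c> + <c,x> - [dx,c], the operator L_c equals -A_c up to
d R_c + R_c d, and it follows that every operation is e + d e' with e and e' in
the span of the words in the A_c and R_c applied to the mark
([semigrown_all]).

Uniqueness.  On the span of those words, d is injective in positive degrees,
and in degree 0 the map to the Lie operad is injective ([grown_exact]).  Hence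
if x = e + d e' is a cycle which in degree 0 maps to 0, then e = 0 and x is a
boundary.  For the injectivity one evaluates operations in an associative
superalgebra: the pairs (X, u) with X odd and u even carry the operations
[(X,u),(Y,v)] = (XY + YX, 0) and <(X,u),(Y,v)> = (Xv - vX, uv - vu), which
satisfy all the relations, the odd part being shifted to degree 0.  An
operation of arity n becomes a combination of words in the letters X_i and u_i,
0 <= i < n ([ev], [ev_eqv], [amalg_ev_rel]).  In the value of d applied to the
word O_m ... O_1 in the operators, A_c or R_c each, look only at words that
begin with the even letter of the mark and contain an odd letter.  Only the
term of d that replaces the first R_c by L_c contributes, and it contributes
exactly one such word, whose other letters are the inputs of O_1, ..., O_m in
this order, odd for R_c and even for A_c ([evP_d_ad_word]).  So the
coefficients of the operator words can be read off. *)

(** * Arithmetic of input labels *)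

Section OuterLabel.
Implicit Types i j k l m n : nat.

Lemma outer_label_lt m n k i j : (m + n = k.+1)%N -> (i < m)%N -> (j < m)%N -> j <> i ->
  (outer_label n i j < k)%N.
Proof. by move=> *; rewrite /outer_label; have [h|h] := ltnP j i; lia. Qed.

Lemma outer_label_neq n i j k : j <> i -> k <> i -> k <> j ->
  outer_label n i k <> outer_label n i j.
Proof. by move=> *; rewrite /outer_label; do 2!case: ltnP => ?; lia. Qed.

Lemma outer_label_neq_inner n i j l : i <> j -> (l < n)%N ->
  (i + l)%N <> outer_label n i j.
Proof. by move=> *; rewrite /outer_label; case: ltnP => ?; lia. Qed.

Lemma outer_label_nest m n i j k : (j < m)%N -> k <> i ->
  outer_label n (i + j) (outer_label m i k) = outer_label (m + n).-1 i k.
Proof.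
by move=> *; rewrite /outer_label; have [h|h] := ltnP k i; case: ltnP => ?; lia.
Qed.

Lemma outer_label_nest_inner n i j l : l <> j ->
  outer_label n (i + j) (i + l) = (i + outer_label n j l)%N.
Proof. by move=> *; rewrite /outer_label ltn_add2l; case: ltnP => ?; lia. Qed.

Lemma outer_label_par m n i j k : i <> j -> k <> i -> k <> j ->
  outer_label n (outer_label m i j) (outer_label m i k) =
  outer_label m (outer_label n j i) (outer_label n j k).
Proof.
move=> *; rewrite /outer_label; have [ij|ij] := ltnP i j; have [ji|ji] := ltnP j i;
  have [ki|ki] := ltnP k i; have [kj|kj] := ltnP k j; try lia;
  by do ?[case: ltnP => ?]; lia.
Qed.

Lemma outer_label_par_inner m n i j l : i <> j -> (l < m)%N ->
  outer_label n (outer_label m i j) (i + l) = (outer_label n j i + l)%N.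
Proof.
move=> *; rewrite /outer_label; have [ij|ij] := ltnP i j; have [ji|ji] := ltnP j i;
  by do ?[case: ltnP => ?]; lia.
Qed.

End OuterLabel.

(** * Coloured words and their substitution *)

(** The letter (i, true) is the odd variable X_i and (i, false) is the even
variable u_i of the superalgebra in which operations are evaluated. *)
Definition letter := (nat * bool)%type.
Definition word := seq letter.

Definition word_odd (W : word) : bool := has snd W.

Arguments word_odd : simpl never.

Lemma word_odd_cons z W : word_odd (z :: W) = z.2 || word_odd W.
Proof. by []. Qed.

Definition relabel (f : nat -> nat) (W : word) : word :=
  [seq (f z.1, z.2) | z <- W].

Definition perm_nat n (s : 'S_n) (l : nat) : nat :=
  if insub l is Some o then val (s o) else l.

(** Substitution of V, with n letters, for the letter labelled i, with the
labels numbered as in a partial composition. *)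
Definition plug n i (U V : word) : word :=
  flatten [seq if z.1 == i then relabel (addn i) V
               else [:: (outer_label n i z.1, z.2)] | z <- U].

Definition odd_after i (U : word) : nat :=
  count snd (drop (index i (unzip1 U)).+1 U).

(** An operation takes odd values through words with an odd letter and even
values through words without, so V can replace only a letter of its own
parity.  The sign is that of moving V, of degree q, past the odd letters to
the right of the place where it is inserted. *)
Definition plug_coef (q : int) i (U V : word) : int :=
  if ((i, true) \in U) == word_odd V then
    if odd `|q|%N && odd (odd_after i U) then -1 else 1
  else 0.

(** The words that occur in the value of an operation of arity n and degree p.
A product of p + 1 odd variables has degree p; a word without odd letters is
the second component of the value and has degree 0. *)
Definition valid n (p : int) (W : word) : bool :=
  perm_eq (unzip1 W) (iota 0 n) && ((count snd W)%:Z == p + (word_odd W : nat)%:Z).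

Lemma word_odd_cat U V : word_odd (U ++ V) = word_odd U || word_odd V.
Proof. exact: has_cat. Qed.

Lemma word_odd_relabel f W : word_odd (relabel f W) = word_odd W.
Proof. by rewrite /word_odd has_map; apply: eq_has. Qed.

Lemma count_relabel f W : count snd (relabel f W) = count snd W.
Proof. by rewrite count_map; apply: eq_count. Qed.

Lemma unzip1_relabel f W : unzip1 (relabel f W) = map f (unzip1 W).
Proof. by rewrite /unzip1 -!map_comp. Qed.

Lemma relabel_cat f U V : relabel f (U ++ V) = relabel f U ++ relabel f V.
Proof. exact: map_cat. Qed.

Lemma relabel_comp f g W : relabel f (relabel g W) = relabel (f \o g) W.
Proof. by rewrite /relabel -map_comp. Qed.

Lemma relabel_id W : relabel id W = W.
Proof. by rewrite -[RHS]map_id; apply: eq_map => -[]. Qed.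

Lemma eq_relabel_in (f g : nat -> nat) W : {in unzip1 W, f =1 g} ->
  relabel f W = relabel g W.
Proof.
move=> fg; apply/eq_in_map => z zW /=; congr (_, _); apply: fg.
exact: (map_f fst zW).
Qed.

Lemma relabel_eq_id (f : nat -> nat) W : {in unzip1 W, forall l, f l = l} ->
  relabel f W = W.
Proof. by move=> H; rewrite -[RHS]relabel_id; apply: eq_relabel_in. Qed.

Section PermNat.
Variable n : nat.
Implicit Types s t : 'S_n.

Lemma perm_natE s (o : 'I_n) : perm_nat s o = s o.
Proof. by rewrite /perm_nat valK. Qed.

Lemma perm_nat_lt s l : (l < n)%N -> (perm_nat s l < n)%N.
Proof. by move=> h; rewrite -[l]/(val (Ordinal h)) perm_natE. Qed.

Lemma perm_nat1 l : perm_nat (1%g : 'S_n) l = l.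
Proof. by rewrite /perm_nat; case: insubP => [o _ El|//]; rewrite perm1. Qed.

Lemma perm_natM s t l : perm_nat (s * t)%g l = perm_nat t (perm_nat s l).
Proof.
have [h|h] := boolP (l < n)%N; last by rewrite /perm_nat !insubN.
by rewrite -[l]/(val (Ordinal h)) !perm_natE permM.
Qed.

Lemma perm_nat_inj s : injective (perm_nat s).
Proof.
by apply: (can_inj (g := perm_nat s^-1%g)) => l; rewrite -perm_natM mulgV perm_nat1.
Qed.

Lemma perm_nat_iota s : perm_eq (map (perm_nat s) (iota 0 n)) (iota 0 n).
Proof.
apply: uniq_perm; rewrite ?iota_uniq // ?(map_inj_uniq (@perm_nat_inj s)) ?iota_uniq //.
move=> l; rewrite mem_iota add0n; apply/mapP/idP => [[l']|h].
  by rewrite mem_iota add0n => h ->; apply: perm_nat_lt.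
exists (perm_nat s^-1%g l); first by rewrite mem_iota add0n perm_nat_lt.
by rewrite -perm_natM mulVg perm_nat1.
Qed.

End PermNat.

Lemma valid_lt n p W : valid n p W -> {in unzip1 W, forall l, (l < n)%N}.
Proof. by case/andP=> /perm_mem h _ l; rewrite h mem_iota. Qed.

Lemma valid_uniq n p W : valid n p W -> uniq (unzip1 W).
Proof. by case/andP=> /perm_uniq -> _; rewrite iota_uniq. Qed.

Lemma valid_odd n p W : valid n p W ->
  odd (count snd W) = odd `|p|%N (+) word_odd W.
Proof. by case/andP=> _; case: word_odd; lia. Qed.

Lemma valid_relabel n p (s : 'S_n) W : valid n p W -> valid n p (relabel (perm_nat s) W).
Proof.
case/andP=> h c; rewrite /valid count_relabel word_odd_relabel c andbT unzip1_relabel.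
by apply: perm_trans (perm_map _ h) (perm_nat_iota s).
Qed.

Lemma valid_split n p W i : valid n p W -> (i < n)%N -> exists P c Q,
  [/\ W = P ++ (i, c) :: Q, i \notin unzip1 P & i \notin unzip1 Q].
Proof.
move=> vW hi; have : i \in unzip1 W.
  by case/andP: vW => /perm_mem -> _; rewrite mem_iota.
case/mapP=> [[i' c]] /= h Ei; subst i'; have u := valid_uniq vW.
case/splitPr: h u => P Q; rewrite /unzip1 map_cat /= cat_uniq /= => /and3P[_ h /andP[iQ _]].
by exists P, c, Q; split=> //; apply: contra h => h; rewrite h.
Qed.

Section Split.
Variables (i : nat) (P Q : word) (c : bool).
Hypotheses (iP : i \notin unzip1 P) (iQ : i \notin unzip1 Q).

Lemma plug_out n W V : i \notin unzip1 W -> plug n i W V = relabel (outer_label n i) W.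
Proof.
rewrite /plug; elim: W => //= z W IH; rewrite inE negb_or eq_sym => /andP[/negPf -> h].
by rewrite IH.
Qed.

Lemma plug_cat n U U' V : plug n i (U ++ U') V = plug n i U V ++ plug n i U' V.
Proof. by rewrite /plug map_cat flatten_cat. Qed.

Lemma plugE n V : plug n i (P ++ (i, c) :: Q) V =
  relabel (outer_label n i) P ++ relabel (addn i) V ++ relabel (outer_label n i) Q.
Proof.
by rewrite plug_cat plug_out // -(plug_out n V iQ) /plug /= eqxx.
Qed.

Lemma odd_afterE : odd_after i (P ++ (i, c) :: Q) = count snd Q.
Proof.
rewrite /odd_after /unzip1 map_cat index_cat (negPf iP) /= eqxx addn0 size_map.
by rewrite drop_cat ltnNge leqnSn /= subSnn /= drop0.
Qed.

Lemma colour_catE : ((i, true) \in P ++ (i, c) :: Q) = c.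
Proof.
rewrite mem_cat inE xpair_eqE eqxx /= (negPf (contra (@map_f _ _ fst P (i, true)) iP)).
by rewrite (negPf (contra (@map_f _ _ fst Q (i, true)) iQ)) orbF; case: c.
Qed.

Lemma plug_coefE q V : plug_coef q i (P ++ (i, c) :: Q) V =
  if c == word_odd V then if odd `|q|%N && odd (count snd Q) then -1 else 1 else 0.
Proof. by rewrite /plug_coef colour_catE odd_afterE. Qed.

End Split.

Lemma outer_label_iota (m n i : nat) : (i < m)%N ->
  map (outer_label n i) (iota 0 i ++ iota i.+1 (m - i.+1)) =
  iota 0 i ++ iota (i + n) (m - i.+1).
Proof.
move=> hi; rewrite map_cat; congr (_ ++ _).
  rewrite -[RHS]map_id; apply/eq_in_map => l; rewrite mem_iota /= => h.
  by rewrite /outer_label h.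
apply: (@eq_from_nth _ 0%N); rewrite !size_map !size_iota // => j hj.
rewrite (nth_map 0%N) ?size_iota // !nth_iota // /outer_label; case: ltnP; lia.
Qed.

Lemma valid_plug m n k p q r i U V : (m + n = k.+1)%N -> p + q = r -> (i < m)%N ->
  valid m p U -> valid n q V -> plug_coef q i U V != 0 -> valid k r (plug n i U V).
Proof.
move=> e f hi vU vV; have [P [c [Q [EU iP iQ]]]] := valid_split vU hi; subst U.
rewrite plug_coefE // plugE //; case: (c =P _) => [Ec _|_]; last by rewrite eqxx.
case/andP: vU => U1 U2; case/andP: vV => V1 V2; apply/andP; split.
  rewrite {1}/unzip1 !map_cat -![map fst _]/(unzip1 _) !unzip1_relabel.
  rewrite perm_catCA -map_cat.
  have h : perm_eq (unzip1 P ++ unzip1 Q) (iota 0 i ++ iota i.+1 (m - i.+1)).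
    have Em : iota 0 m = iota 0 i ++ i :: iota i.+1 (m - i.+1).
      by rewrite -[_ :: iota _ _]/(iota (0 + i) (m - i.+1).+1) -iotaD; congr iota; lia.
    move: U1; rewrite Em /unzip1 map_cat /= => /seq.permP U1; apply/seq.permP => x.
    by have := U1 x; rewrite !count_cat /=; lia.
  have := perm_cat (perm_map (addn i) V1) (perm_map (outer_label n i) h).
  move/perm_trans; apply; rewrite outer_label_iota // -iotaDl addn0 perm_catCA.
  rewrite -iotaD -[X in _ ++ iota X _]add0n -iotaD.
  by have -> : (i + (n + (m - i.+1)) = k)%N by lia.
move: U2 V2; rewrite !count_cat !word_odd_cat !count_relabel !word_odd_relabel /=.
rewrite -Ec; rewrite /word_odd /= -f.
case: (c); case: (has _ P); case: (has _ Q) => /=; lia.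
Qed.

(** * Evaluation of operations on words *)

Section Evaluation.
Variables (G : signature) (gen_words : G -> seq (int * word)).
Hypothesis gen_words_valid : forall g,
  {in gen_words g, forall t, valid (gen_arity g) (gen_degree g) t.2}.

(** The formal sum of words attached to a term is encoded by its pairing with
an arbitrary function phi of words.  Composition is then composition of
functionals, so that the sequential axiom needs no rearrangement of sums.  The
identity is the variable of input 0, of either parity. *)
Fixpoint ev n p (x : term G n p) (phi : word -> int) {struct x} : int :=
  match x with
  | tgen g => \sum_(t <- gen_words g) t.1 * phi t.2
  | tid => phi [:: (0%N, true)] + phi [:: (0%N, false)]
  | tzero _ _ => 0
  | tadd _ _ x y => ev x phi + ev y phi
  | topp _ _ x => - ev x phi
  | tact _ _ s x => ev x (fun W => phi (relabel (perm_nat s) W))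
  | tcomp m n k p q r e f i x y =>
      ev x (fun U => ev y (fun V => plug_coef q i U V * phi (plug n i U V)))
  end.

Lemma ev_ext n p (x : term G n p) (phi psi : word -> int) :
  (forall W, valid n p W -> phi W = psi W) -> ev x phi = ev x psi.
Proof.
elim: x phi psi => {n p} /=.
- move=> g phi psi H; apply: eq_big_seq => t ht; rewrite H //; exact: (gen_words_valid ht).
- by move=> phi psi H; rewrite !H.
- by [].
- by move=> n p x IHx y IHy phi psi H; rewrite (IHx _ _ H) (IHy _ _ H).
- by move=> n p x IHx phi psi H; rewrite (IHx _ _ H).
- by move=> n p s x IHx phi psi H; apply: IHx => W vW; apply: H; apply: valid_relabel.
- move=> m n k p q r e f i x IHx y IHy phi psi H; apply: IHx => U vU; apply: IHy => V vV.
  have [->|nz] := eqVneq (plug_coef q i U V) 0; first by rewrite !mul0r.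
  by rewrite H //; apply: (valid_plug e f (ltn_ord i) vU vV nz).
Qed.

Lemma evD n p (x : term G n p) (phi psi : word -> int) :
  ev x (fun W => phi W + psi W) = ev x phi + ev x psi.
Proof.
elim: x phi psi => {n p} /=.
- by move=> g phi psi; rewrite -big_split; apply: eq_bigr => t _; rewrite mulrDr.
- by move=> phi psi; rewrite addrACA.
- by move=> _ _ phi psi; rewrite addr0.
- by move=> n p x IHx y IHy phi psi; rewrite IHx IHy addrACA.
- by move=> n p x IHx phi psi; rewrite IHx opprD.
- by move=> n p s x IHx phi psi; rewrite -IHx.
- move=> m n k p q r e f i x IHx y IHy phi psi; rewrite -IHx; apply: ev_ext => U _.
  by rewrite -IHy; apply: ev_ext => V _; rewrite mulrDr.
Qed.

Lemma evM n p (x : term G n p) (c : int) (phi : word -> int) :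
  ev x (fun W => c * phi W) = c * ev x phi.
Proof.
elim: x phi => {n p} /=.
- by move=> g phi; rewrite mulr_sumr; apply: eq_bigr => t _; rewrite mulrCA.
- by move=> phi; rewrite mulrDr.
- by move=> _ _ phi; rewrite mulr0.
- by move=> n p x IHx y IHy phi; rewrite IHx IHy mulrDr.
- by move=> n p x IHx phi; rewrite IHx mulrN.
- by move=> n p s x IHx phi; rewrite -IHx.
- move=> m n k p q r e f i x IHx y IHy phi; rewrite -IHx; apply: ev_ext => U _.
  by rewrite -IHy; apply: ev_ext => V _; rewrite mulrCA.
Qed.

Lemma ev0 n p (x : term G n p) : ev x (fun=> 0) = 0.
Proof. by rewrite -[RHS](mul0r (ev x (fun=> 0))) -evM; apply: ev_ext => W _; rewrite mul0r. Qed.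

Lemma ev_zero n p (x : term G n p) phi :
  (forall W, valid n p W -> phi W = 0) -> ev x phi = 0.
Proof. by move=> H; rewrite -(ev0 x); apply: ev_ext. Qed.

Lemma evN n p (x : term G n p) (phi : word -> int) :
  ev x (fun W => - phi W) = - ev x phi.
Proof. by rewrite -mulN1r -evM; apply: ev_ext => W _; rewrite mulN1r. Qed.

Lemma ev_sum n p (x : term G n p) (T : Type) (l : seq T) (F : T -> word -> int) :
  ev x (fun W => \sum_(t <- l) F t W) = \sum_(t <- l) ev x (F t).
Proof.
elim: l => [|t l IH].
  by rewrite big_nil; apply: ev_zero => W _; rewrite big_nil.
by rewrite big_cons -IH -evD; apply: ev_ext => W _; rewrite big_cons.
Qed.

(** A functional of the form [ev x] is a finite sum, so two of them commute;
this is what the parallel axiom needs. *)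
Lemma ev_exchange m n p q (x : term G m p) (y : term G n q) (F : word -> word -> int) :
  ev x (fun U => ev y (F U)) = ev y (fun V => ev x (F^~ V)).
Proof.
elim: x F => {m p} /=.
- move=> g F; rewrite ev_sum; apply: eq_bigr => t _; by rewrite evM.
- by move=> F; rewrite evD.
- by move=> _ _ F; rewrite ev0.
- by move=> m p x IHx x' IHx' F; rewrite IHx IHx' -evD.
- by move=> m p x IHx F; rewrite IHx -evN.
- by move=> m p s x IHx F; rewrite (IHx (fun U V => F (relabel (perm_nat s) U) V)).
- move=> m n' k p q' r e f i x IHx y' IHy F.
  rewrite -(IHx (fun U V => ev y' (fun V' => plug_coef q' i U V' * F (plug n' i U V') V))).
  apply: ev_ext => U _; rewrite -(IHy (fun V' V => plug_coef q' i U V' * F (plug n' i U V') V)).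
  by apply: ev_ext => V _; rewrite evM.
Qed.

Lemma ev_tsign n r p (x : term G n r) phi : ev (tsign p x) phi = ksign p (ev x phi).
Proof. by rewrite /tsign /ksign; case: ifP. Qed.

Lemma plug_coef_id n p (V : word) (phi : word -> int) : valid n p V ->
  plug_coef p 0 [:: (0%N, true)] V * phi V + plug_coef p 0 [:: (0%N, false)] V * phi V
  = phi V.
Proof.
move=> vV; rewrite /plug_coef /odd_after /= andbF !inE /= !xpair_eqE /=.
by case: word_odd; rewrite ?mul0r ?mul1r ?addr0 ?add0r.
Qed.

Lemma ev_unit_l n q (e : (1 + n = n.+1)%N) (f : 0 + q = q) (i : 'I_1) (y : term G n q) phi :
  ev (tcomp e f i tid y) phi = ev y phi.
Proof.
rewrite /= -evD; apply: ev_ext => V vV; rewrite ord1 /=.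
by rewrite /plug /= cats0 relabel_eq_id // (plug_coef_id phi vV).
Qed.

Lemma ev_unit_r m p (e : (m + 1 = m.+1)%N) (f : p + 0 = p) (i : 'I_m) (x : term G m p) phi :
  ev (tcomp e f i x tid) phi = ev x phi.
Proof.
rewrite /=; apply: ev_ext => U vU; have [P [c [Q [-> iP iQ]]]] := valid_split vU (ltn_ord i).
rewrite !plugE // !plug_coefE // /= !relabel_eq_id; last 2 first.
- move=> l; rewrite /outer_label; case: ltnP => //; lia.
- move=> l; rewrite /outer_label; case: ltnP => //; lia.
by rewrite addn0 /word_odd /=; case: c; rewrite /= mul1r mul0r ?addr0 ?add0r.
Qed.

Lemma ksign_mul (V : zmodType) p (x : V) : ksign p x = x *~ (if odd `|p|%N then -1 else 1).
Proof. by rewrite /ksign; case: odd; rewrite ?mulrN1z ?mulr1z. Qed.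

(** The word form of the sequential axiom. *)
Lemma plug_seq (l m n : nat) (i j : nat) p q r (U V Z : word) :
  valid l p U -> valid m q V -> (i < l)%N -> (j < m)%N ->
  plug n (i + j) (plug m i U V) Z = plug (m + n).-1 i U (plug n j V Z) /\
  plug_coef q i U V * plug_coef r (i + j) (plug m i U V) Z =
  plug_coef r j V Z * plug_coef (q + r) i U (plug n j V Z).
Proof.
move=> vU vV hi hj.
have [P [c [Q [EU iP iQ]]]] := valid_split vU hi; subst U.
have [P' [d [Q' [EV jP jQ]]]] := valid_split vV hj; subst V.
have out_notin W : i \notin unzip1 W -> (i + j)%N \notin unzip1 (relabel (outer_label m i) W).
  move=> iW; rewrite unzip1_relabel; apply/mapP => -[a aW].
  by apply: outer_label_neq_inner => // Ea; rewrite Ea aW in iW.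
have in_notin W : j \notin unzip1 W -> (i + j)%N \notin unzip1 (relabel (addn i) W).
  by move=> jW; rewrite unzip1_relabel mem_map //; exact: addnI.
pose A := relabel (outer_label m i) P ++ relabel (addn i) P'.
pose B := relabel (addn i) Q' ++ relabel (outer_label m i) Q.
have EAB : plug m i (P ++ (i, c) :: Q) (P' ++ (j, d) :: Q') = A ++ ((i + j)%N, d) :: B.
  by rewrite plugE // relabel_cat /= /A /B -!catA.
have hA : (i + j)%N \notin unzip1 A.
  by rewrite /unzip1 map_cat mem_cat negb_or out_notin ?in_notin.
have hB : (i + j)%N \notin unzip1 B.
  by rewrite /unzip1 map_cat mem_cat negb_or out_notin ?in_notin.
rewrite EAB !plug_coefE // !plugE //; split; last first.
  rewrite !word_odd_cat !word_odd_relabel !count_cat !count_relabel /=.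
  case: (d == _) / eqP => [->|_]; last by rewrite mulr0 mul0r.
  rewrite word_odd_cons /=; case: (c == _); last by rewrite mulr0 mul0r.
  rewrite odd_abszD oddD; case: (odd _) (odd _) (odd _) (odd _) => [] [] [] [] //=;
  by rewrite ?mulr1 ?mul1r ?mulrNN.
rewrite /A /B !relabel_cat !relabel_comp -!catA.
have Eout W : i \notin unzip1 W ->
    relabel (outer_label n (i + j) \o outer_label m i) W = relabel (outer_label (m + n).-1 i) W.
  move=> iW; apply: eq_relabel_in => a aW; apply: outer_label_nest => // Ea.
  by rewrite -Ea aW in iW.
have Ein W : j \notin unzip1 W ->
    relabel (outer_label n (i + j) \o addn i) W = relabel (addn i \o outer_label n j) W.
  move=> jW; apply: eq_relabel_in => a aW; apply: outer_label_nest_inner => Ea.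
  by rewrite -Ea aW in jW.
rewrite !Eout // !Ein //; do 3!congr (_ ++ _).
by apply: eq_relabel_in => a _ /=; rewrite addnA.
Qed.

(** When b stands to the left of a, the two orders of insertion differ in the
number of odd letters that Z passes: V has replaced the letter a or not.  This
changes the number by q modulo 2, whence the sign (-1)^(qr). *)
Lemma plug_par_order (l m n : nat) (a b : nat) p q r c d (P M Q V Z : word) :
  let U := P ++ (b, d) :: M ++ (a, c) :: Q in
  let a' := outer_label n b a in let b' := outer_label m a b in
  valid l p U -> valid m q V -> valid n r Z ->
  plug n b' (plug m a U V) Z = plug m a' (plug n b U Z) V /\
  plug_coef q a U V * plug_coef r b' (plug m a U V) Z =
    (if odd `|(q * r)%R|%N then -1 else 1) *
    (plug_coef r b U Z * plug_coef q a' (plug n b U Z) V).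
Proof.
move=> U a' b' vU vV vZ.
have Vlt := valid_lt vV; have Zlt := valid_lt vZ.
have /= : uniq (a :: b :: unzip1 P ++ unzip1 M ++ unzip1 Q).
  rewrite -[is_true _]/(_ = true) -[in RHS](valid_uniq vU).
  apply: perm_uniq; apply/seq.permP => x.
  by rewrite /U /unzip1 !(map_cat, map_cons) /= !count_cat /= !count_cat /=; lia.
rewrite !inE !mem_cat !negb_or => /and3P[] /and4P[ab aP aM aQ] /and3P[bP bM bQ] _.
have ba : b != a by rewrite eq_sym.
have [/eqP ab' /eqP ba'] := (ab, ba).
have out_notin k x y (W : word) : y <> x -> x \notin unzip1 W -> y \notin unzip1 W ->
    outer_label k x y \notin unzip1 (relabel (outer_label k x) W).
  move=> yx xW yW; rewrite unzip1_relabel; apply/mapP => -[z zW /esym].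
  by apply: outer_label_neq => // Ez; [rewrite -Ez zW in xW|rewrite -Ez zW in yW].
have in_notin k x y (W : word) : x <> y -> {in unzip1 W, forall z, (z < k)%N} ->
    outer_label k x y \notin unzip1 (relabel (addn x) W).
  move=> xy Wlt; rewrite unzip1_relabel; apply/mapP => -[z /Wlt zk /esym].
  exact: outer_label_neq_inner.
have EW W : a \notin unzip1 W -> b \notin unzip1 W ->
    relabel (outer_label n b') (relabel (outer_label m a) W) =
    relabel (outer_label m a') (relabel (outer_label n b) W).
  move=> aW bW; rewrite !relabel_comp; apply: eq_relabel_in => z zW /=.
  by apply: outer_label_par => // Ez; [rewrite -Ez zW in aW|rewrite -Ez zW in bW].
have EV : relabel (outer_label n b') (relabel (addn a) V) = relabel (addn a') V.
  rewrite relabel_comp; apply: eq_relabel_in => z /Vlt zm /=.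
  exact: outer_label_par_inner.
have EZ : relabel (addn b') Z = relabel (outer_label m a') (relabel (addn b) Z).
  rewrite relabel_comp; apply: eq_relabel_in => z /Zlt zn /=.
  by rewrite outer_label_par_inner.
have Vodd := valid_odd vV.
have EU : U = (P ++ (b, d) :: M) ++ (a, c) :: Q by rewrite -catA.
have E1 : plug m a U V = relabel (outer_label m a) P ++ (b', d) ::
    (relabel (outer_label m a) M ++ relabel (addn a) V ++ relabel (outer_label m a) Q).
  rewrite EU plugE //; first by rewrite relabel_cat -catA.
  by rewrite /unzip1 map_cat mem_cat inE /= !negb_or aP ab.
have E2 : plug n b U Z = (relabel (outer_label n b) P ++ relabel (addn b) Z ++
    relabel (outer_label n b) M) ++ (a', c) :: relabel (outer_label n b) Q.
  rewrite {1}/U plugE //; first by rewrite relabel_cat -!catA.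
  by rewrite /unzip1 map_cat mem_cat inE /= !negb_or bM ba.
have r1 : b' \notin unzip1 (relabel (outer_label m a) M ++ relabel (addn a) V ++
    relabel (outer_label m a) Q).
  by rewrite /unzip1 !map_cat !mem_cat !negb_or !out_notin ?in_notin.
have r2 : a' \notin unzip1 (relabel (outer_label n b) P ++ relabel (addn b) Z ++
    relabel (outer_label n b) M).
  by rewrite /unzip1 !map_cat !mem_cat !negb_or !out_notin ?in_notin.
have rU1 : a \notin unzip1 (P ++ (b, d) :: M).
  by rewrite /unzip1 map_cat mem_cat inE /= !negb_or aP ab.
have rU2 : b \notin unzip1 (M ++ (a, c) :: Q).
  by rewrite /unzip1 map_cat mem_cat inE /= !negb_or bM ba.
rewrite E1 E2 !plugE ?out_notin //; split.
  by rewrite !relabel_cat !EW // EV EZ -!catA.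
have C1 := plug_coefE c rU1 aQ q V; rewrite -EU in C1.
have C2 : plug_coef r b U Z = _ := plug_coefE d bP rU2 r Z.
rewrite C1 C2 !plug_coefE ?out_notin //.
rewrite abszM oddM ?count_cat /= ?count_cat ?count_relabel /=.
case: (c =P _) => [Ec|_]; last by rewrite mul0r !mulr0.
case: (d =P _) => [Ed|_]; last by rewrite mul0r !mulr0.
rewrite !oddD Vodd -Ec; case: (odd `|q|%N); case: (odd `|r|%N) => //=;
by case: (c); case: (odd _); case: (odd _).
Qed.

Lemma plug_par (l m n : nat) (i j : nat) p q r (U V Z : word) :
  valid l p U -> valid m q V -> valid n r Z -> i != j -> (i < l)%N -> (j < l)%N ->
  plug n (outer_label m i j) (plug m i U V) Z =
    plug m (outer_label n j i) (plug n j U Z) V /\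
  plug_coef q i U V * plug_coef r (outer_label m i j) (plug m i U V) Z =
    (if odd `|(q * r)%R|%N then -1 else 1) *
    (plug_coef r j U Z * plug_coef q (outer_label n j i) (plug n j U Z) V).
Proof.
move=> vU vV vZ ij hi hj; have [P [c [Q [EU iP iQ]]]] := valid_split vU hi.
have : j \in unzip1 U by case/andP: vU => /perm_mem -> _; rewrite mem_iota.
rewrite EU /unzip1 map_cat mem_cat inE /= eq_sym (negPf ij) /=.
case/orP => /mapP[[j0 d] jin /= Ej]; subst j0; move: vU; rewrite EU.
  case/splitPr: jin => P1 P2; rewrite -catA /= => vU.
  exact: plug_par_order vU vV vZ.
case/splitPr: jin => Q1 Q2 vU; have [-> E] := plug_par_order vU vZ vV.
by split=> //; rewrite E (mulrC r q) mulrA; case: odd; rewrite ?mulrNN ?mul1r.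
Qed.

Lemma plug_act m n k p q (i : 'I_m) (s : 'S_m) (t : 'S_n) (u : 'S_k) (U V : word) :
  (m + n = k.+1)%N -> block_perm i s t u -> valid m p U -> valid n q V ->
  plug n (s i) (relabel (perm_nat s) U) (relabel (perm_nat t) V) =
    relabel (perm_nat u) (plug n i U V) /\
  plug_coef q (s i) (relabel (perm_nat s) U) (relabel (perm_nat t) V) = plug_coef q i U V.
Proof.
move=> e [u_in u_out] vU vV; have Ult := valid_lt vU; have Vlt := valid_lt vV.
have [P [c [Q [EU iP iQ]]]] := valid_split vU (ltn_ord i); subst U.
have s_notin (W : word) : (i : nat) \notin unzip1 W ->
    (s i : nat) \notin unzip1 (relabel (perm_nat s) W).
  by rewrite unzip1_relabel -perm_natE mem_map //; exact: perm_nat_inj.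
have E : relabel (perm_nat s) (P ++ (val i, c) :: Q) =
    relabel (perm_nat s) P ++ (val (s i), c) :: relabel (perm_nat s) Q.
  by rewrite relabel_cat /= perm_natE.
rewrite E !plugE ?s_notin // !plug_coefE ?s_notin // word_odd_relabel count_relabel.
split=> //; rewrite !relabel_cat !relabel_comp.
have Eout W : (i : nat) \notin unzip1 W -> {in unzip1 W, forall l, (l < m)%N} ->
    relabel (outer_label n (s i) \o perm_nat s) W =
    relabel (perm_nat u \o outer_label n i) W.
  move=> iW Wlt; apply: eq_relabel_in => a aW /=; have am := Wlt a aW.
  have ai : Ordinal am != i by apply: contraNneq iW => <-.
  have [lk El] : exists l : 'I_k, l = outer_label n i a :> nat.
    have lk : (outer_label n i a < k)%N.
      by apply: (outer_label_lt e (ltn_ord i) am) => Ea; case/eqP: ai; apply: val_inj.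
    by exists (Ordinal lk).
  rewrite -El perm_natE (u_out _ _ ai El).
  by rewrite -[a]/(val (Ordinal am)) perm_natE.
rewrite !Eout //; first last.
- by move=> l lP; apply: Ult; rewrite /unzip1 map_cat mem_cat lP.
- by move=> l lQ; apply: Ult; rewrite /unzip1 map_cat mem_cat /= inE lQ !orbT.
congr (_ ++ (_ ++ _)); apply: eq_relabel_in => j /Vlt jn /=.
have lk : (i + j < k)%N by have := ltn_ord i; lia.
rewrite -[(i + j)%N]/(val (Ordinal lk)) perm_natE (u_in (Ordinal jn)) //.
by rewrite -[j]/(val (Ordinal jn)) perm_natE.
Qed.

Variable R : relations G.
Hypothesis ev_rel : forall n p (x y : term G n p), R x y -> ev x =1 ev y.

(** Functionals of words satisfy the axioms of graded operads, so a choice of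
values of the generators that respects the relations gives well-defined values
of the classes. *)
Lemma ev_eqv n p (x y : term G n p) : eqv R x y -> ev x =1 ev y.
Proof.
elim=> {n p x y}.
- exact: ev_rel.
- by [].
- by move=> n p x y _ IH phi; rewrite IH.
- by move=> n p x y z _ IH1 _ IH2 phi; rewrite IH1 IH2.
- by move=> n p x x' y y' _ IH1 _ IH2 phi /=; rewrite IH1 IH2.
- by move=> n p x x' _ IH phi /=; rewrite IH.
- by move=> n p s x x' _ IH phi /=; rewrite IH.
- move=> m n k p q r e f i x x' y y' _ IHx _ IHy phi /=; rewrite IHx.
  by apply: ev_ext => U _; rewrite IHy.
- by move=> n p x y z phi /=; rewrite addrA.
- by move=> n p x y phi /=; rewrite addrC.
- by move=> n p x phi /=; rewrite add0r.
- by move=> n p x phi /=; rewrite addNr.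
- by [].
- move=> n p x phi /=; apply: ev_ext => W _; congr phi.
  by apply: relabel_eq_id => l _; rewrite perm_nat1.
- move=> n p s t x phi /=; apply: ev_ext => W _; congr phi.
  by rewrite relabel_comp; apply: eq_relabel_in => l _; rewrite perm_natM.
- by [].
- by move=> m n k p q r e f i x y y' phi /=; rewrite -evD.
- by move=> n q e f i y phi; rewrite ev_unit_l.
- by move=> m p e f i x phi; rewrite ev_unit_r.
- move=> l m n k1 k2 k p q r t1 t2 t e1 f1 e2 f2 e3 f3 e4 f4 i j ij x y z Eij phi /=.
  apply: ev_ext => U vU; apply: ev_ext => V vV; rewrite -!evM; apply: ev_ext => Z vZ.
  have [E1 E2] := plug_seq n r Z vU vV (ltn_ord i) (ltn_ord j).
  have -> : k2 = (m + n).-1 by rewrite e3.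
  by rewrite !mulrA Eij E1 E2 f3.
- move=> l m n k1 k2 k p q r t1 t2 t e1 f1 e2 f2 e3 f3 e4 f4 i j j' i' x y z ltij Ej Ei phi.
  rewrite ev_tsign ksign_mul -mulrzl mulrzl -mulrzr intz mulrC -evM /=; apply: ev_ext => U vU.
  transitivity (ev y (fun V => ev z (fun Z => plug_coef q i U V *
     (plug_coef r j' (plug m i U V) Z * phi (plug n j' (plug m i U V) Z))))).
    by apply: ev_ext => V _; rewrite evM.
  rewrite ev_exchange; apply: ev_ext => Z vZ; rewrite -evM; apply: ev_ext => V vV.
  have ij : (i : nat) != j by rewrite neq_ltn ltij.
  have [E1 E2] := plug_par vU vV vZ ij (ltn_ord i) (ltn_ord j).
  by rewrite Ej Ei !mulrA E1 E2 [X in X * _]mulrC.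
- move=> m n k p q r e f i s t u x y Hu phi /=.
  apply: ev_ext => U vU; apply: ev_ext => V vV.
  by have [-> ->] := plug_act e Hu vU vV.
Qed.

Definition evc n p (x : presented R n p) (phi : word -> int) : int :=
  ev (generic_quotient.repr x) phi.

Lemma evcE n p (x : term G n p) phi : evc (cls R x) phi = ev x phi.
Proof. exact/ev_eqv/repr_eqv. Qed.

Lemma evc_ext n p (x : presented R n p) (phi psi : word -> int) :
  (forall W, valid n p W -> phi W = psi W) -> evc x phi = evc x psi.
Proof. exact: ev_ext. Qed.

Lemma evc_zero n p (x : presented R n p) phi :
  (forall W, valid n p W -> phi W = 0) -> evc x phi = 0.
Proof. exact: ev_zero. Qed.

Lemma evc_addr n p (x : presented R n p) (phi psi : word -> int) :
  evc x (fun W => phi W + psi W) = evc x phi + evc x psi.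
Proof. exact: evD. Qed.

Lemma evc_oppr n p (x : presented R n p) (phi : word -> int) :
  evc x (fun W => - phi W) = - evc x phi.
Proof. exact: evN. Qed.

Lemma evcD n p (x y : presented R n p) phi : evc (x + y) phi = evc x phi + evc y phi.
Proof. by elim/cls_ind: x => x; elim/cls_ind: y => y; rewrite -clsD !evcE. Qed.

Lemma evcN n p (x : presented R n p) phi : evc (- x) phi = - evc x phi.
Proof. by elim/cls_ind: x => x; rewrite -clsN !evcE. Qed.

Lemma evc0 n p phi : evc (0 : presented R n p) phi = 0.
Proof. by rewrite -cls0 evcE. Qed.

Lemma evc_act n p (s : 'S_n) (x : presented R n p) phi :
  evc (op_act s x) phi = evc x (fun W => phi (relabel (perm_nat s) W)).
Proof. by elim/cls_ind: x => x; rewrite -cls_act !evcE. Qed.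

Lemma evc_id phi : evc (op_id (presented R)) phi = phi [:: (0%N, true)] + phi [:: (0%N, false)].
Proof. by rewrite -cls_id evcE. Qed.

Lemma evc_comp m n k p q r (e : (m + n = k.+1)%N) (f : p + q = r) (i : 'I_m)
    (x : presented R m p) (y : presented R n q) phi :
  evc (op_comp e f i x y) phi =
  evc x (fun U => evc y (fun V => plug_coef q i U V * phi (plug n i U V))).
Proof.
elim/cls_ind: x => x; elim/cls_ind: y => y; rewrite -cls_comp !evcE /=.
by apply: ev_ext => U _; rewrite evcE.
Qed.

End Evaluation.

(** * Operations generated from the mark *)

Local Notation P := (presented amalg_rel).
Local Notation d := (@pder amalg_sig amalg_rel amalg_dgen _ _ _).

Section Grow.

Definition gen (g : amalg_gen) : P 2 (amalg_degree g) := cls amalg_rel (@tgen amalg_sig g).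

(** The operation that maps x and y to <y,x>: composition with it is the
operator L. *)
Definition angle_op : P 2 0 := op_act transp (gen Angle).

Let o1 : 'I_3 := @Ordinal 3 1 isT.
Let o2 : 'I_3 := @Ordinal 3 2 isT.
Definition swap12 : 'S_3 := tperm o1 o2.
Let sigma := swap12.

Lemma swap12_0 : sigma ord0 = ord0. Proof. by rewrite tpermD. Qed.

Lemma swap12_1 : sigma o1 = o2. Proof. by rewrite tpermL. Qed.

Lemma swap12_2 : sigma o2 = o1. Proof. by rewrite tpermR. Qed.

Let permS3 := (permM, rho0, rho1, rho2, cycle3_0, cycle3_1, cycle3_2, perm1,
  swap12_0, swap12_1, swap12_2).

Lemma rho_cycle3_swap : (tperm ord0 o1 * cycle3 = sigma)%g.
Proof. by apply: perm_ext3; rewrite !permS3. Qed.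

Lemma rho_swap_cycle3 : (tperm ord0 o1 * sigma = cycle3)%g.
Proof. by apply: perm_ext3; rewrite !permS3. Qed.

Lemma block_transp : block_perm (ord0 : 'I_2) transp (1%g : 'S_2) (cycle3 * cycle3)%g.
Proof.
split.
- move=> [[|[|//]] hj] l /= El; rewrite perm1 tpermL.
    by rewrite (_ : l = ord0) ?permS3 //; apply: val_inj.
  by rewrite (_ : l = o1) ?permS3 //; apply: val_inj.
- move=> [[|[|//]] ha] l //= _ El.
  have -> : Ordinal ha = ord_max by apply: val_inj.
  by rewrite (_ : l = o2) ?tpermR ?tpermL ?permS3 //; apply: val_inj.
Qed.

Let comp0 (p q r : int) (f : p + q = r) (x : P 2 p) (y : P 2 q) : P 3 r :=
  op_comp (erefl : (2 + 2 = 4)%N) f ord0 x y.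
Let comp1 (p q r : int) (f : p + q = r) (x : P 2 p) (y : P 2 q) : P 3 r :=
  op_comp (erefl : (2 + 2 = 4)%N) f ord_max x y.

Lemma transpK p (x : P 2 p) : op_act transp (op_act transp x) = x.
Proof. by rewrite -op_actM tperm2 op_act1. Qed.

Lemma comp1E p q r (f : p + q = r) x y :
  comp1 f x y = op_act cycle3 (op_act cycle3 (comp0 f (op_act transp x) y)).
Proof.
have := op_comp_act (erefl : (2 + 2 = 4)%N) f (op_act transp x) y block_transp.
by rewrite transpK op_act1 tpermL op_actM.
Qed.

Lemma square_sym : op_act transp (gen Square) = gen Square.
Proof. by rewrite -cls_act; exact: amalg_rel_cls amalg_sym. Qed.

Let rho : 'S_3 := tperm ord0 o1.
Let AA := comp0 (erefl : 0 + 0 = 0 :> int) (gen Angle) (gen Angle).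
Let BB := comp0 (erefl : 0 + 0 = 0 :> int) angle_op (gen Angle).
Let left_AA : op_act cycle3 (op_act rho AA) + op_act cycle3 (op_act cycle3 BB) = AA.
Proof. exact: left_A. Qed.

(** The next four lemmas move a composite out of the second argument:
<x,<y,z>> = <<x,y>,z> - <<x,z>,y>. *)
Lemma angle_angle1 : comp1 (erefl : 0 + 0 = 0 :> int) (gen Angle) (gen Angle) =
  comp0 (erefl : 0 + 0 = 0 :> int) (gen Angle) (gen Angle) -
  op_act sigma (comp0 (erefl : 0 + 0 = 0 :> int) (gen Angle) (gen Angle)).
Proof.
rewrite -/AA comp1E -/angle_op -/BB -{1}left_AA -(op_actM rho cycle3) rho_cycle3_swap.
by rewrite addrC addKr.
Qed.

(** [x,<y,z>] = <[x,y],z> - [<x,z>,y]. *)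
Lemma square_angle1 : comp1 (erefl : 1 + 0 = 1 :> int) (gen Square) (gen Angle) =
  comp0 (erefl : 0 + 1 = 1 :> int) (gen Angle) (gen Square) -
  op_act sigma (comp0 (erefl : 1 + 0 = 1 :> int) (gen Square) (gen Angle)).
Proof.
by rewrite comp1E square_sym -[comp0 _ (gen Angle) _]deriv_cls -(op_actM rho cycle3)
  rho_cycle3_swap addrK.
Qed.

(** <x,[y,z]> = 0. *)
Lemma angle_square1 : comp1 (erefl : 0 + 1 = 1 :> int) (gen Angle) (gen Square) = 0.
Proof. by rewrite comp1E [comp0 _ _ _]right_cls !op_act0. Qed.

(** [x,[y,z]] = - [[x,y],z] - [[x,z],y], without Koszul sign because the
composite [-,[-,-]] is here a relabelling of [[-,-],-]. *)
Lemma square_square1 : comp1 (erefl : 1 + 1 = 2 :> int) (gen Square) (gen Square) =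
  - comp0 (erefl : 1 + 1 = 2 :> int) (gen Square) (gen Square) -
  op_act sigma (comp0 (erefl : 1 + 1 = 2 :> int) (gen Square) (gen Square)).
Proof.
rewrite comp1E square_sym; set J := comp0 _ _ _.
have := amalg_rel_cls amalg_jacobi; rewrite /tau /tcomp1 !clsD !cls_act !cls_comp.
rewrite -[op_comp _ _ _ _ _]/J => /eqP; rewrite addr_eq0 => /eqP E.
have EJ : op_act (tperm ord0 o1) J = J by rewrite -comp1_transp square_sym.
by rewrite -rho_cycle3_swap op_actM EJ -opprD E opprK.
Qed.

(** <z,<x,y>> = <<z,x>,y> - <<z,y>,x>, with x as first input.  This moves L
past A. *)
Lemma angle_op_angle0 : comp0 (erefl : 0 + 0 = 0 :> int) angle_op (gen Angle) =
  op_act sigma (comp0 (erefl : 0 + 0 = 0 :> int) (gen Angle) angle_op) -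
  comp1 (erefl : 0 + 0 = 0 :> int) angle_op angle_op.
Proof.
have E : comp0 (erefl : 0 + 0 = 0 :> int) (gen Angle) angle_op = op_act rho AA.
  exact: comp1_transp.
rewrite -/BB comp1E transpK E -(op_actM rho sigma) rho_swap_cycle3.
by rewrite -{1}left_AA op_actD act_ccc addrAC subrr add0r.
Qed.

Lemma d_angle (q : int) (e : q + 1 = 0) : d e (gen Angle) = 0.
Proof. exact: amalg_d_angle. Qed.

Lemma d_square (e : 0 + 1 = 1 :> int) : d e (gen Square) = gen Angle + angle_op.
Proof. exact: amalg_d_square. Qed.

Lemma d_angle_op (q : int) (e : q + 1 = 0) : d e angle_op = 0.
Proof. by rewrite /angle_op (pder_act amalg_der_rel) d_angle op_act0. Qed.

Lemma dD n (p q : int) (e : q + 1 = p) (x y : P n p) : d e (x + y) = d e x + d e y.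
Proof. exact: (pderD amalg_der_rel). Qed.

Lemma dN n (p q : int) (e : q + 1 = p) (x : P n p) : d e (- x) = - d e x.
Proof. exact: (pderN amalg_der_rel). Qed.

Definition d_comp := pder_comp amalg_der_rel.

(** Two operators A or R in a row, applied to the first input, with the new
inputs in any order. *)
Inductive grown3 : forall p : int, P 3 p -> Prop :=
| grown3_0 p : grown3 (0 : P 3 p)
| grown3_D p (x y : P 3 p) : grown3 x -> grown3 y -> grown3 (x + y)
| grown3_N p (x : P 3 p) : grown3 x -> grown3 (- x)
| grown3_gen g h (r : int) (f : amalg_degree g + amalg_degree h = r) (s : 'S_3) :
    s ord0 = ord0 -> grown3 (op_act s (comp0 f (gen g) (gen h))).

Lemma grown3_gen1 g h (r : int) (f : amalg_degree g + amalg_degree h = r) :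
  grown3 (comp0 f (gen g) (gen h)).
Proof. by rewrite -[comp0 _ _ _]op_act1; apply: grown3_gen; rewrite perm1. Qed.

Lemma gen_comp1_grown g h (r : int) (f : amalg_degree g + amalg_degree h = r) :
  grown3 (comp1 f (gen g) (gen h)).
Proof.
case: g h f => [] [] /= f; case: r / f.
- rewrite angle_angle1; apply: grown3_D; first exact: (@grown3_gen1 Angle Angle).
  by apply/grown3_N/(@grown3_gen Angle Angle)/swap12_0.
- rewrite angle_square1; exact: grown3_0.
- rewrite square_angle1; apply: grown3_D; first exact: (@grown3_gen1 Angle Square).
  by apply/grown3_N/(@grown3_gen Square Angle)/swap12_0.
- rewrite square_square1; apply: grown3_D; first exact/grown3_N/(@grown3_gen1 Square Square).
  by apply/grown3_N/(@grown3_gen Square Square)/swap12_0.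
Qed.

(** [grown j x]: x lies in the span of the words in the operators A_c and R_c
applied to the mark, which is the input j.  The operators add an input with
the last label; the other orders come from relabelling. *)
Inductive grown : forall n (p : int), 'I_n -> P n p -> Prop :=
| grown_id : grown ord0 (op_id P)
| grown_0 n p (j : 'I_n) : grown j (0 : P n p)
| grown_D n p (j : 'I_n) (x y : P n p) : grown j x -> grown j y -> grown j (x + y)
| grown_N n p (j : 'I_n) (x : P n p) : grown j x -> grown j (- x)
| grown_act n p (s : 'S_n) (j j' : 'I_n) (x : P n p) : j' = s j ->
    grown j x -> grown j' (op_act s x)
| grown_gen g n k p r (e : (2 + n = k.+1)%N) (f : amalg_degree g + p = r)
    (j : 'I_n) (j' : 'I_k) (x : P n p) : j' = j :> nat -> grown j x ->
    grown j' (op_comp e f ord0 (gen g) x).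

Lemma grown_comp3 n k p q r (e : (3 + n = k.+1)%N) (f : p + q = r) (y : P 3 p) (x : P n q)
    (j : 'I_n) (j' : 'I_k) :
  grown3 y -> grown j x -> j' = j :> nat -> grown j' (op_comp e f ord0 y x).
Proof.
move=> gy gx Ej; elim: gy r f => {p y} [p|p y y' _ IHy _ IHy'|p y _ IHy|g h t f s s0] r f'.
- by rewrite op_comp0l; apply: grown_0.
- by rewrite op_compDl; apply: grown_D.
- by rewrite op_compNl; apply: grown_N.
have [u Hu] := block_perm_exists e ord0 s (1%g : 'S_n).
have := op_comp_act e f' (comp0 f (gen g) (gen h)) x Hu; rewrite s0 op_act1 => ->.
have jk : (j < k)%N by have := ltn_ord j; lia.
apply: (@grown_act _ _ u (Ordinal jk)).
  by apply: val_inj; rewrite /= (Hu.1 j) // s0 perm1.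
have n1 : (2 + n = n.+1.+1)%N by lia.
have n2 : (2 + n.+1 = k.+1)%N by lia.
have j1 : (j < n.+1)%N by have := ltn_ord j; lia.
rewrite (op_comp_seq _ f e f' n1 (erefl (amalg_degree h + q)) n2 _ (i := ord0) (j := ord0)) //.
  by rewrite -f' -f addrA.
move=> f4; apply: (@grown_gen g _ _ _ _ _ _ (Ordinal j1)) => //.
exact: (@grown_gen h _ _ _ _ _ _ j).
Qed.

(** Plugging a generator into an unmarked input c of a word commutes with all
operators but A_c or R_c, whose second argument it makes composite. *)
Lemma grown_comp_gen n k p r g (e : (n + 2 = k.+1)%N) (f : p + amalg_degree g = r)
    (x : P n p) (i j : 'I_n) (j' : 'I_k) :
  grown j x -> i != j -> j' = outer_label 2 i j :> nat -> grown j' (op_comp e f i x (gen g)).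
Proof.
move=> gx; elim: gx k r e f i j' => {n p j x}
  [|n p j|n p j x y _ IHx _ IHy|n p j x _ IHx|n p s j j1 x -> _ IHx
  |h n m p t e1 f1 j j1 x Ej gx IHx]
  k r e f i j' ij Ej'.
- by rewrite !ord1 in ij.
- by rewrite op_comp0l; apply: grown_0.
- by rewrite op_compDl; apply: grown_D; [apply: IHx|apply: IHy].
- by rewrite op_compNl; apply: grown_N; apply: IHx.
- have [u Hu] := block_perm_exists e (s^-1%g i) s (1%g : 'S_2).
  have := op_comp_act e f x (gen g) Hu; rewrite permKV op_act1 => ->.
  have ij1 : s^-1%g i != j by apply: contraNneq ij => <-; rewrite permKV.
  have jk : (outer_label 2 (s^-1%g i) j < k)%N.
    by apply: (outer_label_lt e) => //; move=> /val_inj Ej; rewrite Ej eqxx in ij1.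
  apply: (@grown_act _ _ u (Ordinal jk)); last exact: IHx.
  apply: val_inj; rewrite /= Ej' (Hu.2 j) //; first by rewrite permKV.
  by rewrite eq_sym.
(* Either i is an input of x, or it is the one added by the outer generator. *)
have [lt_in|le_ni] := ltnP i n.
  have n1 : (n + 2 = n.+1.+1)%N by lia.
  have n2 : (2 + n.+1 = k.+1)%N by lia.
  have j2 : (outer_label 2 i j < n.+1)%N.
    by apply: (outer_label_lt n1) => //; move=> Eij; case/eqP: ij; apply: val_inj; rewrite /= Ej.
  have f2 : amalg_degree h + (p + amalg_degree g) = r by rewrite -f -f1 addrA.
  rewrite (op_comp_seq e1 f1 e f n1 (erefl (p + amalg_degree g)) n2 f2 (i := ord0)
    (j := Ordinal lt_in)) //.
  apply: (@grown_gen h _ _ _ _ _ _ (Ordinal j2)); first by rewrite /= Ej' Ej.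
  apply: IHx => //; apply: contraNneq ij => Eij; apply/eqP/val_inj.
  by rewrite /= Ej -Eij.
have Ei : i = n :> nat by have := ltn_ord i; lia.
have f2 : amalg_degree h + amalg_degree g = r - p by rewrite -f -f1 (addrAC _ p) addrK.
have f3 : r - p + p = r by rewrite subrK.
have e3 : (3 + n = k.+1)%N by lia.
rewrite (op_comp_par e1 f1 e f (erefl : (2 + 2 = 4)%N) f2 e3 f3 (i := ord0) (j := ord_max)
  (i' := ord0)) //.
have gz : grown j' (op_comp e3 f3 ord0 (comp1 f2 (gen h) (gen g)) x).
  apply: (grown_comp3 e3 f3 (gen_comp1_grown f2) gx); rewrite Ej' Ej /outer_label.
  by rewrite Ei ltn_ord.
by rewrite /ksign; case: ifP => // _; apply: grown_N.
Qed.

Definition semigrown n (p : int) (j : 'I_n) (x : P n p) : Prop :=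
  exists x0 x1, [/\ grown j x0, grown j x1 & x = x0 + d (erefl (p + 1)) x1].

Lemma d0 n (p q : int) (e : q + 1 = p) : d e (0 : P n p) = 0.
Proof. exact: (pder0 amalg_der_rel). Qed.

Lemma dd n (p q r : int) (e : q + 1 = p) (e' : r + 1 = q) (x : P n p) : d e' (d e x) = 0.
Proof. exact: (pder_pder amalg_der_rel amalg_dgen_cycle). Qed.

Lemma d_act n (p q : int) (e : q + 1 = p) (s : 'S_n) (x : P n p) :
  d e (op_act s x) = op_act s (d e x).
Proof. exact: (pder_act amalg_der_rel). Qed.

Lemma grown_semi n (p : int) (j : 'I_n) (x : P n p) : grown j x -> semigrown j x.
Proof. by move=> gx; exists x, 0; split; [|exact: grown_0|rewrite d0 addr0]. Qed.

Lemma grown_bdry n (p : int) (j : 'I_n) q (e : p + 1 = q) (x : P n q) :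
  grown j x -> semigrown j (d e x).
Proof. by case: q / e x => x gx; exists 0, x; split; [exact: grown_0| |rewrite add0r]. Qed.

Lemma semigrownD n (p : int) (j : 'I_n) (x y : P n p) :
  semigrown j x -> semigrown j y -> semigrown j (x + y).
Proof.
move=> [x0 [x1 [gx0 gx1 ->]]] [y0 [y1 [gy0 gy1 ->]]]; exists (x0 + y0), (x1 + y1).
by split; [apply: grown_D|apply: grown_D|rewrite dD addrACA].
Qed.

Lemma semigrownN n (p : int) (j : 'I_n) (x : P n p) : semigrown j x -> semigrown j (- x).
Proof.
move=> [x0 [x1 [gx0 gx1 ->]]]; exists (- x0), (- x1).
by split; [apply: grown_N|apply: grown_N|rewrite dN opprD].
Qed.

Lemma semigrown_sign n (p q : int) (j : 'I_n) (x : P n p) :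
  semigrown j x -> semigrown j (ksign q x).
Proof. by rewrite /ksign; case: ifP => // _; apply: semigrownN. Qed.

Lemma semigrown0 n (p : int) (j : 'I_n) : semigrown j (0 : P n p).
Proof. exact/grown_semi/grown_0. Qed.

Lemma semigrown_act n (p : int) (s : 'S_n) (j j' : 'I_n) (x : P n p) :
  j' = s j -> semigrown j x -> semigrown j' (op_act s x).
Proof.
move=> Ej [x0 [x1 [gx0 gx1 ->]]]; exists (op_act s x0), (op_act s x1).
by rewrite op_actD d_act; split=> //; apply: (grown_act Ej).
Qed.

Lemma semigrown_d n (p q : int) (e : q + 1 = p) (j : 'I_n) (x : P n p) :
  semigrown j x -> semigrown j (d e x).
Proof.
move=> [x0 [x1 [gx0 _ ->]]]; rewrite dD dd addr0; exact: grown_bdry.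
Qed.

(** The operations <-,-> and <1,0> are cycles, so composition with them
commutes with d. *)
Lemma comp_gen_d_l n k (p q r : int) (e : (n + 2 = k.+1)%N) (f : p + 0 = r)
    (g : p + 1 = q) (h : r + 1 = q + 0) (i : 'I_n) (x : P n q) (y : P 2 0) :
  (forall q' (e' : q' + 1 = 0), d e' y = 0) ->
  op_comp e f i (d g x) y = d h (op_comp e (erefl (q + 0)) i x y).
Proof.
move=> dy; have f1 : q + (0 - 1) = r by rewrite -f -g; ring.
rewrite (d_comp e (erefl (q + 0)) f f1 g (erefl : 0 - 1 + 1 = 0 :> int) h).
by rewrite dy op_comp0r ksign0 addr0.
Qed.

Lemma comp_gen_d_r n k (p q r : int) (e : (2 + n = k.+1)%N) (f : 0 + p = r)
    (g : p + 1 = q) (h : r + 1 = 0 + q) (x : P n q) (y : P 2 0) (i : 'I_2) :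
  (forall q' (e' : q' + 1 = 0), d e' y = 0) ->
  op_comp e f i y (d g x) = d h (op_comp e (erefl (0 + q)) i y x).
Proof.
move=> dy; have f1 : 0 - 1 + q = r by rewrite -f -g; ring.
rewrite (d_comp e (erefl (0 + q)) f1 f (erefl : 0 - 1 + 1 = 0 :> int) g h).
by rewrite dy op_comp0l add0r.
Qed.

Lemma grown_comp_angle_op n k p r (e : (n + 2 = k.+1)%N) (f : p + 0 = r)
    (x : P n p) (i j : 'I_n) (j' : 'I_k) :
  grown j x -> i != j -> j' = outer_label 2 i j :> nat -> grown j' (op_comp e f i x angle_op).
Proof.
move=> gx ij Ej'; have [u Hu] := block_perm_exists e i (1%g : 'S_n) transp.
have := op_comp_act e f x (gen Angle) Hu; rewrite perm1 op_act1 => ->.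
apply: (@grown_act _ _ u j'); last exact: (grown_comp_gen (g := Angle) e f gx ij).
by apply: val_inj; rewrite /= (Hu.2 j) ?perm1 // eq_sym.
Qed.

Lemma semigrown_comp_angle_op n k p r (e : (n + 2 = k.+1)%N) (f : p + 0 = r)
    (x : P n p) (i j : 'I_n) (j' : 'I_k) :
  semigrown j x -> i != j -> j' = outer_label 2 i j :> nat ->
  semigrown j' (op_comp e f i x angle_op).
Proof.
move=> [x0 [x1 [gx0 gx1 ->]]] ij Ej'; rewrite op_compDl; apply: semigrownD.
  exact/grown_semi/(grown_comp_angle_op e f gx0 ij).
have h : r + 1 = p + 1 + 0 by rewrite -f; ring.
rewrite (comp_gen_d_l _ _ _ h); last exact: d_angle_op.
exact/grown_bdry/(grown_comp_angle_op e _ gx1 ij).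
Qed.

(** For the square bracket, d(x o [-,-]) produces (dx) o [-,-] and the terms
x o <-,-> and x o <1,0>, which are grown. *)
Lemma semigrown_comp_gen n k p r g (e : (n + 2 = k.+1)%N) (f : p + amalg_degree g = r)
    (x : P n p) (i j : 'I_n) (j' : 'I_k) :
  semigrown j x -> i != j -> j' = outer_label 2 i j :> nat ->
  semigrown j' (op_comp e f i x (gen g)).
Proof.
move=> [x0 [x1 [gx0 gx1 ->]]] ij Ej'; rewrite op_compDl; apply: semigrownD.
  exact/grown_semi/(grown_comp_gen e f gx0 ij).
case: g f => /= f.
  have h : r + 1 = p + 1 + 0 by rewrite -f; ring.
  rewrite (comp_gen_d_l _ _ _ h); last exact: d_angle.
  exact/grown_bdry/(grown_comp_gen (g := Angle) e _ gx1 ij).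
have h : r + 1 = p + 1 + 1 by rewrite -f.
have f1 : p + 1 + 0 = r by rewrite -f addr0.
have := d_comp e (erefl (p + 1 + 1)) f f1 (erefl (p + 1)) (erefl : 0 + 1 = 1 :> int) h i x1
  (gen Square).
rewrite d_square => /esym/(canRL (addrK _)) ->; apply: semigrownD.
  exact/grown_bdry/(grown_comp_gen (g := Square) e _ gx1 ij).
apply/semigrownN/semigrown_sign/grown_semi; rewrite op_compDr; apply: grown_D.
  exact: (grown_comp_gen (g := Angle) e f1 gx1 ij).
exact: (grown_comp_angle_op e f1 gx1 ij).
Qed.

Lemma semigrown_angle n k p r (e : (2 + n = k.+1)%N) (f : 0 + p = r)
    (j : 'I_n) (j' : 'I_k) (x : P n p) : j' = j :> nat -> semigrown j x ->
  semigrown j' (op_comp e f ord0 (gen Angle) x).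
Proof.
move=> Ej [x0 [x1 [gx0 gx1 ->]]]; rewrite op_compDr; apply: semigrownD.
  exact/grown_semi/(grown_gen (g := Angle) e f Ej).
have h : r + 1 = 0 + (p + 1) by rewrite -f; ring.
rewrite (comp_gen_d_r e f _ h); last exact: d_angle.
exact/grown_bdry/(grown_gen (g := Angle) e _ Ej).
Qed.

(** The operator L preserves what is generated from the mark: on the mark
itself L = d R - A, on a word L A = A L minus L with a composite argument, and
L R = 0.  The composite argument is reached by plugging <1,0> into the input
added by the operator L. *)
Lemma grown_angle_op n k p r (e : (2 + n = k.+1)%N) (f : 0 + p = r)
    (j : 'I_n) (j' : 'I_k) (x : P n p) : j' = j :> nat -> grown j x ->
  semigrown j' (op_comp e f ord0 angle_op x).
Proof.
move=> Ej gx; elim: gx k r e f j' Ej => {n p j x}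
  [|n p j|n p j x y _ IHx _ IHy|n p j x _ IHx|n p s j j1 x -> _ IHx
  |g n m p t e1 f1 j j1 x Ej1 gx IHx]
  k r e f j' Ej.
- have Ek : k = 2 by lia.
  subst k; have Er : r = 0 by rewrite -f addr0.
  subst r; rewrite op_compIr.
  have g1 h : grown j' (gen h).
    rewrite -(op_compIr (erefl : (2 + 1 = 3)%N) (addr0 _) ord0 (gen h)).
    exact: grown_gen grown_id.
  have <- : d (erefl : 0 + 1 = 1 :> int) (gen Square) - gen Angle = angle_op.
    by rewrite d_square addrC addKr.
  apply: semigrownD; first exact: (grown_bdry (erefl : 0 + 1 = 1 :> int) (g1 Square)).
  exact: (semigrownN (grown_semi (g1 Angle))).
- by rewrite op_comp0r; apply: semigrown0.
- by rewrite op_compDr; apply: semigrownD; [apply: IHx|apply: IHy].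
- by rewrite op_compNr; apply: semigrownN; apply: IHx.
- have [u Hu] := block_perm_exists e ord0 (1%g : 'S_2) s.
  have := op_comp_act e f angle_op x Hu; rewrite perm1 op_act1 => ->.
  have jk : (j < k)%N by have := ltn_ord j; lia.
  apply: (@semigrown_act _ _ u (Ordinal jk)); last exact: IHx.
  by apply: val_inj; rewrite /= Ej (Hu.1 j) // perm1.
have n1 : (2 + 2 = 4)%N by [].
have n2 : (3 + n = k.+1)%N by lia.
have f2 : amalg_degree g + p = r by rewrite -f add0r.
have f3 : 0 + amalg_degree g = amalg_degree g by rewrite add0r.
rewrite -(op_comp_seq n1 f3 n2 f2 e1 f1 e f (i := ord0) (j := ord0) (ij := ord0)) //.
case: g f1 f2 f3 => /= f1 f2 f3; last first.
  rewrite [op_comp n1 _ _ _ _](_ : _ = 0) ?op_comp0l; first exact: semigrown0.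
  by rewrite -[RHS]right_cls; congr op_comp; apply: eq_irrelevance.
have -> : op_comp n1 f3 ord0 angle_op (gen Angle) = op_act swap12
    (comp0 (erefl : 0 + 0 = 0 :> int) (gen Angle) angle_op) -
    comp1 (erefl : 0 + 0 = 0 :> int) angle_op angle_op.
  by rewrite -angle_op_angle0; congr op_comp; apply: eq_irrelevance.
have mn : m = n.+1 by lia.
subst m; have jm : (j < n.+1)%N by rewrite -Ej1 ltn_ord.
have semi_x : semigrown (Ordinal jm) (op_comp e1 f1 ord0 angle_op x) by apply: IHx.
have f4 : 0 + t = r by rewrite -f1 -f2 !add0r.
rewrite /comp0 /comp1 op_compDl op_compNl; apply: semigrownD; last apply: semigrownN.
  have [u Hu] := block_perm_exists n2 ord0 swap12 (1%g : 'S_n).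
  have := op_comp_act n2 f2 (op_comp (erefl : (2 + 2 = 4)%N)
    (erefl : 0 + 0 = 0 :> int) ord0 (gen Angle) angle_op) x Hu.
  rewrite swap12_0 op_act1 => ->.
  rewrite (op_comp_seq (erefl : (2 + 2 = 4)%N) _ n2 f2 e1 f1 e f4 (i := ord0)
    (j := ord0) (ij := ord0)) //.
  have jk : (j < k)%N by have := ltn_ord j; lia.
  apply: (@semigrown_act _ _ u (Ordinal jk)).
    by apply: val_inj; rewrite /= Ej Ej1 (Hu.1 j) // swap12_0 perm1.
  exact: (semigrown_angle e f4 _ semi_x).
have e4 : (n.+1 + 2 = k.+1)%N by lia.
have f5 : t + 0 = r by rewrite -f4 addrC.
have n_lt : (n < n.+1)%N by [].
have := op_comp_par e1 f1 e4 f5 (erefl : (2 + 2 = 4)%N) (erefl : 0 + 0 = 0 :> int) n2 f2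
  (i := ord0) (j := ord_max)
  (j' := Ordinal n_lt) (i' := ord0) angle_op x angle_op erefl erefl erefl.
move=> /(congr1 (ksign (p * 0))); rewrite ksignK => <-; apply: semigrown_sign.
apply: (semigrown_comp_angle_op e4 f5 semi_x).
  by rewrite -val_eqE /= neq_ltn ltn_ord orbT.
by rewrite /= Ej Ej1 /outer_label ltn_ord.
Qed.

Lemma semigrown_angle_op n k p r (e : (2 + n = k.+1)%N) (f : 0 + p = r)
    (j : 'I_n) (j' : 'I_k) (x : P n p) : j' = j :> nat -> semigrown j x ->
  semigrown j' (op_comp e f ord0 angle_op x).
Proof.
move=> Ej [x0 [x1 [gx0 gx1 ->]]]; rewrite op_compDr; apply: semigrownD.
  exact: grown_angle_op Ej gx0.
have h : r + 1 = 0 + (p + 1) by rewrite -f; ring.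
rewrite (comp_gen_d_r e f _ h); last exact: d_angle_op.
exact/semigrown_d/(grown_angle_op e _ Ej).
Qed.

(** For the square bracket, R d = A + L - d R. *)
Lemma semigrown_gen g n k p r (e : (2 + n = k.+1)%N) (f : amalg_degree g + p = r)
    (j : 'I_n) (j' : 'I_k) (x : P n p) : j' = j :> nat -> semigrown j x ->
  semigrown j' (op_comp e f ord0 (gen g) x).
Proof.
case: g f => f Ej; first exact: semigrown_angle.
move=> [x0 [x1 [gx0 gx1 ->]]]; rewrite op_compDr; apply: semigrownD.
  exact/grown_semi/(grown_gen (g := Square) e f Ej).
have h : r + 1 = 1 + (p + 1) by rewrite -f /=; ring.
have f1 : 0 + (p + 1) = r by rewrite -f /=; ring.
have := d_comp e (erefl (1 + (p + 1))) f1 f (erefl : 0 + 1 = 1 :> int) (erefl (p + 1)) h ord0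
  (gen Square) x1.
rewrite d_square {1}/ksign /= => /esym/(canRL (addKr _)) E.
rewrite -[op_comp _ _ _ _ _]opprK E; apply: semigrownN; apply: semigrownD; last first.
  exact/grown_bdry/(grown_gen (g := Square) e _ Ej).
apply: semigrownN; rewrite op_compDl; apply: semigrownD.
  exact/grown_semi/(grown_gen (g := Angle) e _ Ej).
exact: grown_angle_op Ej gx1.
Qed.

(** Plugging a marked element into x, and plugging x into an unmarked input,
both preserve [semigrown]: the two properties together pass to partial
compositions of x, and the preceding lemmas give them for the generators.  The
claim is the first property for the mark itself. *)
Lemma semigrown_all n p (x : P n p) (j : 'I_n) : semigrown j x.
Proof.
suff [H _] : (forall (m k : nat) (q r : int) (e : (n + m = k.+1)%N) (f : p + q = r) (i : 'I_n)
     (j : 'I_m) (j' : 'I_k) (z : P m q), j' = (i + j)%N :> nat -> semigrown j z ->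
     semigrown j' (op_comp e f i x z)) /\
   (forall (m k : nat) (q r : int) (e : (m + n = k.+1)%N) (f : q + p = r) (i j : 'I_m)
     (j' : 'I_k) (z : P m q), i != j -> j' = outer_label n i j :> nat -> semigrown j z ->
     semigrown j' (op_comp e f i z x)).
  have e1 : (n + 1 = n.+1)%N by rewrite addn1.
  rewrite -(op_compIr e1 (addr0 p) j x); apply: (H _ _ _ _ _ _ _ ord0); first by rewrite addn0.
  exact/grown_semi/grown_id.
elim/cls_ind: x => x {j}; elim: x => {n p}
  [g||n p|n p x [IHx1 IHx2] y [IHy1 IHy2]|n p x [IHx1 IHx2]|n p s x [IHx1 IHx2]
  |m n k p q r e f i x [IHx1 IHx2] y [IHy1 IHy2]]; split.
- move=> m k q r e f i j j' z Ej Sz; have [E0|E1] : i = ord0 \/ i = ord_max.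
  + by case: i {Ej} => -[|[|//]] ?; [left|right]; apply: val_inj.
  + by subst i; apply: (semigrown_gen (g := g) e f Ej Sz).
  subst i; have [u Hu] := block_perm_exists e ord0 transp (1%g : 'S_m).
  have := op_comp_act e f (op_act transp (gen g)) z Hu; rewrite transpK op_act1 tpermL => ->.
  have jk : (j < k)%N by have := ltn_ord j; rewrite /= in e; lia.
  apply: (@semigrown_act _ _ u (Ordinal jk)).
    by apply: val_inj; rewrite /= Ej (Hu.1 j) // tpermL perm1.
  case: (g) f => f; first exact: (semigrown_angle_op e f _ Sz).
  by rewrite square_sym; apply: (semigrown_gen (g := Square) e f _ Sz).
- move=> m k q r e f i j j' z ij Ej Sz; exact: (semigrown_comp_gen e f Sz ij).
- move=> m k q r e f i j j' z; have Ek : k = m by lia.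
  subst k; have Er : q = r by rewrite -f add0r.
  by case: r / Er f => f; rewrite cls_id op_compIl ord1 add0n => /val_inj ->.
- move=> m k q r e f i j j' z ij; have Ek : k = m by lia.
  subst k; have Er : q = r by rewrite -f addr0.
  case: r / Er f => f; rewrite cls_id op_compIr (_ : outer_label 1 i j = j);
    first by move/val_inj ->.
  by rewrite /outer_label; case: ltnP => //; rewrite addn1.
- by move=> *; rewrite cls0 op_comp0l; apply: semigrown0.
- by move=> *; rewrite cls0 op_comp0r; apply: semigrown0.
- move=> m k q r e f i j j' z Ej Sz; rewrite clsD op_compDl; apply: semigrownD.
    exact: IHx1 Ej Sz.
  exact: IHy1 Ej Sz.
- move=> m k q r e f i j j' z ij Ej Sz; rewrite clsD op_compDr; apply: semigrownD.
    exact: IHx2 ij Ej Sz.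
  exact: IHy2 ij Ej Sz.
- move=> m k q r e f i j j' z Ej Sz; rewrite clsN op_compNl; apply: semigrownN.
  exact: IHx1 Ej Sz.
- move=> m k q r e f i j j' z ij Ej Sz; rewrite clsN op_compNr; apply: semigrownN.
  exact: IHx2 ij Ej Sz.
- move=> m k q r e f i j j' z Ej Sz; rewrite cls_act.
  have [u Hu] := block_perm_exists e (s^-1%g i) s (1%g : 'S_m).
  have := op_comp_act e f (cls amalg_rel x) z Hu; rewrite permKV op_act1 => ->.
  have jk : (s^-1%g i + j < k)%N.
    by have := ltn_ord j; have := ltn_ord (s^-1%g i); lia.
  apply: (@semigrown_act _ _ u (Ordinal jk)); last exact: IHx1 Sz.
  by apply: val_inj; rewrite /= Ej (Hu.1 j) // permKV perm1.
- move=> m k q r e f i j j' z ij Ej Sz; rewrite cls_act.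
  have [u Hu] := block_perm_exists e i (1%g : 'S_m) s.
  have := op_comp_act e f z (cls amalg_rel x) Hu; rewrite perm1 op_act1 => ->.
  apply: (@semigrown_act _ _ u j'); last exact: IHx2 ij Ej Sz.
  by apply: val_inj; rewrite /= (Hu.2 j) ?perm1 // eq_sym.
- move=> l k' s t e' f' l0 j j' z Ej Sz; rewrite cls_comp.
  have [hi [hl hj]] := (ltn_ord i, (ltn_ord l0, ltn_ord j)).
  have [/andP[il lin]|l_out] := boolP (i <= l0 < i + n)%N.
    have jn : (l0 - i < n)%N by lia.
    have e3 : (n + l = (n + l).-1.+1)%N by lia.
    have e4 : (m + (n + l).-1 = k'.+1)%N by lia.
    have f4 : p + (q + s) = t by rewrite -f' -f addrA.
    have jnl : (l0 - i + j < (n + l).-1)%N by lia.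
    rewrite (op_comp_seq e f e' f' e3 (erefl (q + s)) e4 f4 (i := i) (j := Ordinal jn)) /=;
      last by lia.
    apply: (IHx1 _ _ _ _ e4 f4 i (Ordinal jnl)); first by rewrite /= Ej; lia.
    exact: (IHy1 _ _ _ _ e3 _ (Ordinal jn) j).
  have e1 : (m + l = (m + l).-1.+1)%N by lia.
  have e4 : ((m + l).-1 + n = k'.+1)%N by lia.
  have f4 : p + s + q = t by rewrite -f' -f; ring.
  (* l0 comes from the input a of x, and the two insertions are parallel. *)
  pose a := if (l0 < i)%N then (l0 : nat) else (l0 - n).+1.
  have am : (a < m)%N by rewrite /a; case: ifP => ?; lia.
  have ajm : (a + j < (m + l).-1)%N by lia.
  have im : (outer_label l a i < (m + l).-1)%N.
    by apply: (outer_label_lt e1) => //; rewrite /a; case: ifP => ?; lia.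
  have El0 : l0 = outer_label n i a :> nat.
    by rewrite /a /outer_label; have [la|la] := ltnP l0 i; [rewrite la|case: ltnP => ?; lia].
  have ai : a <> i by rewrite /a; case: ifP => ?; lia.
  have E : op_comp e' f' l0 (op_comp e f i (cls amalg_rel x) (cls amalg_rel y)) z =
      ksign (q * s) (op_comp e4 f4 (Ordinal im)
        (op_comp e1 (erefl (p + s)) (Ordinal am) (cls amalg_rel x) z) (cls amalg_rel y)).
    have [la|la] := ltnP l0 i.
      have Ea : a = l0 by rewrite /a la.
      have lt_ai : (Ordinal am < i)%N by rewrite /= Ea.
      rewrite (op_comp_par e1 (erefl (p + s)) e4 f4 e f e' f' (j' := Ordinal im) (i' := l0)
        _ _ _ lt_ai erefl El0).
      by rewrite mulrC ksignK.
    have Ea : a = (l0 - n).+1 by rewrite /a ltnNge la.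
    have lt_ia : (i < Ordinal am)%N by rewrite /= Ea; lia.
    by rewrite (op_comp_par e f e' f' e1 (erefl (p + s)) e4 f4 (i' := Ordinal im)
      _ _ _ lt_ia El0 erefl).
  rewrite E; apply: semigrown_sign.
  apply: (IHy2 _ _ _ _ e4 f4 (Ordinal im) (Ordinal ajm)).
  - by apply/eqP => /(congr1 val) /= /esym; apply: outer_label_neq_inner.
  - by rewrite /= outer_label_par_inner // Ej El0.
  - exact: (IHx1 _ _ _ _ e1 _ (Ordinal am) j).
- move=> l k' s t e' f' j0 j j' z ij Ej Sz; rewrite cls_comp.
  have [hi [hl hj]] := (ltn_ord i, (ltn_ord j0, ltn_ord j)).
  have jj : (j : nat) <> j0 by move/val_inj => Ejj; rewrite Ejj eqxx in ij.
  have e1 : (l + m = (l + m).-1.+1)%N by lia.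
  have e2 : ((l + m).-1 + n = k'.+1)%N by lia.
  have f2 : s + p + q = t by rewrite -f' -f addrA.
  have jlm : (outer_label m j0 j < (l + m).-1)%N by apply: (outer_label_lt e1).
  have ilm : (j0 + i < (l + m).-1)%N by lia.
  rewrite -(op_comp_seq e1 (erefl (s + p)) e2 f2 e f e' f' (ij := Ordinal ilm)) //.
  apply: (IHy2 _ _ _ _ e2 f2 (Ordinal ilm) (Ordinal jlm)).
  - by apply/eqP => /(congr1 val) /=; apply: outer_label_neq_inner => // /esym.
  - by rewrite /= outer_label_nest // Ej e.
  - exact: (IHx2 _ _ _ _ e1 _ j0 j).
Qed.
End Grow.

(** * Values of the generators *)

Definition bracket_words : seq (int * word) :=
  [:: (1, [:: (0%N, false); (1%N, false)]); (-1, [:: (1%N, false); (0%N, false)])].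

(** [(X_0,u_0),(X_1,u_1)] and <(X_0,u_0),(X_1,u_1)>, both components listed
together. *)
Definition amalg_words (g : amalg_sig) : seq (int * word) :=
  match g with
  | Angle => [:: (1, [:: (0%N, true); (1%N, false)]), (-1, [:: (1%N, false); (0%N, true)])
              & bracket_words]
  | Square => [:: (1, [:: (0%N, true); (1%N, true)]); (1, [:: (1%N, true); (0%N, true)])]
  end.

Definition lie_words (g : lie_sig) : seq (int * word) := bracket_words.

Lemma amalg_words_valid (g : amalg_sig) :
  {in amalg_words g, forall t, valid (gen_arity g) (gen_degree g) t.2}.
Proof. by apply/allP; case: g. Qed.

Lemma lie_words_valid (g : lie_sig) :
  {in lie_words g, forall t, valid (gen_arity g) (gen_degree g) t.2}.
Proof. by apply/allP; case: g. Qed.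

Lemma perm_nat_transp : (perm_nat transp 0 = 1%N) * (perm_nat transp 1 = 0%N).
Proof.
split; first by rewrite -[X in perm_nat _ X]/(val (ord0 : 'I_2)) perm_natE tpermL.
by rewrite -[X in perm_nat _ X]/(val (ord_max : 'I_2)) perm_natE tpermR.
Qed.

Lemma perm_nat_cycle3 : (perm_nat cycle3 0 = 2%N) * (perm_nat cycle3 1 = 0%N) *
  (perm_nat cycle3 2 = 1%N).
Proof.
split; first split.
- by rewrite -[X in perm_nat _ X]/(val (ord0 : 'I_3)) perm_natE cycle3_0.
- by rewrite -[X in perm_nat _ X]/(val (@Ordinal 3 1 isT)) perm_natE cycle3_1.
- by rewrite -[X in perm_nat _ X]/(val (@Ordinal 3 2 isT)) perm_natE cycle3_2.
Qed.

Lemma ev_angle phi : ev amalg_words ang12 phi =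
  phi [:: (0%N, true); (1%N, false)] - phi [:: (1%N, false); (0%N, true)] +
  (phi [:: (0%N, false); (1%N, false)] - phi [:: (1%N, false); (0%N, false)]).
Proof. by rewrite /= !big_cons big_nil /= addr0 !mul1r !mulN1r addrA. Qed.

Lemma ev_square phi : ev amalg_words sq12 phi =
  phi [:: (0%N, true); (1%N, true)] + phi [:: (1%N, true); (0%N, true)].
Proof. by rewrite /= !big_cons big_nil /= addr0 !mul1r. Qed.

Lemma amalg_ev_rel n p (x y : term amalg_sig n p) : amalg_rel x y ->
  ev amalg_words x =1 ev amalg_words y.
Proof.
have evtr (p' : int) (z : term amalg_sig 2 p') psi : ev amalg_words (tact transp z) psi =
  ev amalg_words z (fun W => psi (relabel (perm_nat transp) W)) by [].
have evc p' q' (z : term amalg_sig 2 p') (z' : term amalg_sig 2 q') psi :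
  ev amalg_words (tcomp1 z z') psi = ev amalg_words z (fun U => ev amalg_words z' (fun V =>
    plug_coef q' 0 U V * psi (plug 2 0 U V))) by [].
have ev_tau (p' : int) (z : term amalg_sig 3 p') psi : ev amalg_words (tau z) psi =
  ev amalg_words z (fun W => psi (relabel (perm_nat cycle3) W)) by [].
have evA (p' : int) (z z' : term amalg_sig 3 p') psi : ev amalg_words (tadd z z') psi =
  ev amalg_words z psi + ev amalg_words z' psi by [].
have evO (p' : int) (z : term amalg_sig 3 p') psi : ev amalg_words (topp z) psi =
  - ev amalg_words z psi by [].
have out2 : outer_label 2 0 1 = 2%N by [].
case => {n p x y} phi.
- by rewrite evtr !ev_square /= !perm_nat_transp addrC.
2: rewrite [RHS](evc _ _ ang12 sq12).
all: rewrite ?(evA, evO, ev_tau, evc, evtr, ev_angle, ev_square) /plug /plug_coef /odd_after /=.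
all: rewrite /word_odd /= ?perm_nat_transp /= ?out2 ?add0n ?perm_nat_cycle3 ?perm_nat_cycle3; ring.
Qed.

Lemma lie_ev_rel n p (x y : term lie_sig n p) : lie_rel x y ->
  ev lie_words x =1 ev lie_words y.
Proof.
have ev_bracket psi : ev lie_words bracket psi =
    psi [:: (0%N, false); (1%N, false)] - psi [:: (1%N, false); (0%N, false)].
  by rewrite /= !big_cons big_nil /= addr0 !mul1r !mulN1r.
have evc psi : ev lie_words (bracket o_1 bracket)%OT psi =
  ev lie_words bracket (fun U => ev lie_words bracket (fun V =>
    plug_coef 0 0 U V * psi (plug 2 0 U V))) by [].
have evT (p' : int) (z : term lie_sig 3 p') psi : ev lie_words (tau z) psi =
  ev lie_words z (fun W => psi (relabel (perm_nat cycle3) W)) by [].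
have evA (p' : int) (z z' : term lie_sig 3 p') psi : ev lie_words (tadd z z') psi =
  ev lie_words z psi + ev lie_words z' psi by [].
have out2 : outer_label 2 0 1 = 2%N by [].
case => {n p x y} [|J] phi.
- rewrite -[LHS]/(ev lie_words bracket (fun W => phi (relabel (perm_nat transp) W))).
  rewrite -[RHS]/(- ev lie_words bracket phi) !ev_bracket /= !perm_nat_transp; ring.
rewrite {}/J ?(evA, evT, evc, ev_bracket) /plug /plug_coef /odd_after /=.
by rewrite /word_odd /= ?out2 ?add0n ?perm_nat_cycle3 ?perm_nat_cycle3; ring.
Qed.

(** * Leading words *)

Local Notation evP := (@evc _ amalg_words amalg_rel _ _).
Local Notation evL := (@evc _ lie_words lie_rel _ _).
Local Notation evP_comp := (evc_comp amalg_words_valid amalg_ev_rel).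
Local Notation evL_comp := (evc_comp lie_words_valid lie_ev_rel).

Lemma relabel_add0 W : relabel (addn 0) W = W.
Proof. exact: relabel_id. Qed.

Lemma outer_label01 n : outer_label n 0 1 = n.
Proof. by []. Qed.

Lemma evP_angle n k p r (e : (2 + n = k.+1)%N) (f : 0 + p = r) (x : P n p) phi :
  evP (op_comp e f ord0 (gen Angle) x) phi =
  evP x (fun V => phi (rcons V (n, false)) - phi ((n, false) :: V)).
Proof.
rewrite evP_comp (evcE amalg_words_valid amalg_ev_rel) [ev _ _ _]ev_angle.
rewrite -!(evc_oppr amalg_words_valid) -!(evc_addr amalg_words_valid).
apply: (evc_ext amalg_words_valid) => V _.
rewrite /plug /plug_coef /odd_after /= !relabel_add0 !cats0 !outer_label01 !andbF /= -cats1.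
by case: word_odd; rewrite !mul1r !mul0r ?subr0 ?add0r ?addr0.
Qed.

Lemma evP_square n k p r (e : (2 + n = k.+1)%N) (f : 1 + p = r) (x : P n p) phi :
  evP (op_comp e f ord0 (gen Square) x) phi =
  evP x (fun V => if word_odd V then
    ksign p (phi (rcons V (n, true))) + phi ((n, true) :: V) else 0).
Proof.
rewrite evP_comp (evcE amalg_words_valid amalg_ev_rel) [ev _ _ _]ev_square.
rewrite -!(evc_addr amalg_words_valid).
apply: (evc_ext amalg_words_valid) => V _.
rewrite /plug /plug_coef /odd_after /= !relabel_add0 !cats0 !outer_label01 !andbF /= -cats1 andbT.
by case: word_odd; rewrite ?mul0r ?addr0 // mul1r /ksign; case: odd; rewrite ?mulN1r ?mul1r.
Qed.

Lemma evP_angle_op n k p r (e : (2 + n = k.+1)%N) (f : 0 + p = r) (x : P n p) phi :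
  evP (op_comp e f ord0 angle_op x) phi =
  evP x (fun V => if word_odd V then 0 else
    phi ((n, true) :: V) - phi (rcons V (n, true)) +
    (phi ((n, false) :: V) - phi (rcons V (n, false)))).
Proof.
rewrite evP_comp (evc_act amalg_words_valid amalg_ev_rel).
rewrite (evcE amalg_words_valid amalg_ev_rel) [ev _ _ _]ev_angle /= !perm_nat_transp.
rewrite -!(evc_oppr amalg_words_valid) -!(evc_addr amalg_words_valid).
apply: (evc_ext amalg_words_valid) => V vV.
rewrite /plug /plug_coef /odd_after /= !relabel_add0 !cats0 !outer_label01 !andbF /= -!cats1.
(* An even word V has degree p = 0, so there is no sign. *)
have := valid_odd vV; case Vo: word_odd => /=; first by move=> _; rewrite !mul0r !subrr.
rewrite addbF => <-; rewrite (_ : count snd V = 0%N) ?mul1r //.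
by apply/eqP; rewrite -leqn0 leqNgt -has_count -[has _ _]/(word_odd V) Vo.
Qed.

Definition bracket_op : presented lie_rel 2 0 := cls lie_rel bracket.

Lemma evL_bracket n k p r (e : (2 + n = k.+1)%N) (f : 0 + p = r)
    (x : presented lie_rel n p) phi :
  evL (op_comp e f ord0 bracket_op x) phi =
  evL x (fun V => if word_odd V then 0 else phi (rcons V (n, false)) - phi ((n, false) :: V)).
Proof.
rewrite evL_comp (evcE lie_words_valid lie_ev_rel) /= !big_cons big_nil /= addr0 mul1r mulN1r.
rewrite -!(evc_oppr lie_words_valid) -!(evc_addr lie_words_valid).
apply: (evc_ext lie_words_valid) => V _.
rewrite /plug /plug_coef /odd_after /= !relabel_add0 !cats0 !outer_label01 !andbF /= -!cats1.
by case: word_odd; rewrite ?mul1r ?mul0r ?subr0.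
Qed.

Lemma add1_pred (p : int) : 1 + (p - 1) = p.
Proof. by rewrite addrC subrK. Qed.

(** The word in the operators A and R of arity n and degree p, outermost
operator first, with true for R.  It is meant for size w = n - 1 and p the
number of operators R; the head operator adds the input n - 1. *)
Fixpoint ad_word (n : nat) : forall p : int, seq bool -> P n p :=
  match n return forall p : int, seq bool -> P n p with
  | 0 => fun p w => 0
  | n'.+1 =>
    match n' return (forall p : int, seq bool -> P n' p) ->
      forall p : int, seq bool -> P n'.+1 p with
    | 0 => fun _ p w => match p return P 1 p with Posz 0 => op_id P | _ => 0 end
    | k.+1 => fun rec p w =>
        if head false w then
          op_comp (erefl : (2 + k.+1 = k.+3)%N) (add1_pred p) ord0 (gen Square)
            (rec (p - 1) (behead w))
        else op_comp (erefl : (2 + k.+1 = k.+3)%N) (add0r p) ord0 (gen Angle) (rec p (behead w))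
    end (ad_word n')
  end.

Lemma ad_word_cons n p c w : ad_word n.+2 p (c :: w) =
  if c then op_comp (erefl : (2 + n.+1 = n.+3)%N) (add1_pred p) ord0 (gen Square)
    (ad_word n.+1 (p - 1) w)
  else op_comp (erefl : (2 + n.+1 = n.+3)%N) (add0r p) ord0 (gen Angle) (ad_word n.+1 p w).
Proof. by []. Qed.

(** The even letter of the mark followed by the inputs in the order in which
the operators add them. *)
Definition star_word (w : seq bool) : word := (0%N, false) :: zip (iota 1 (size w)) (rev w).

Lemma star_word_cons c w : star_word (c :: w) = rcons (star_word w) ((size w).+1, c).
Proof.
have E : iota 1 (size w).+1 = rcons (iota 1 (size w)) (size w).+1.
  by rewrite -{1}(addn1 (size w)) iotaD cats1 add1n.
by rewrite /star_word rev_cons -[size (c :: w)]/(size w).+1 E zip_rcons ?size_iota ?size_rev.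
Qed.

Lemma word_odd_rcons W z : word_odd (rcons W z) = word_odd W || z.2.
Proof. by rewrite -cats1 word_odd_cat word_odd_cons orbF. Qed.

Lemma word_odd_star w : word_odd (star_word w) = has id w.
Proof. by elim: w => // c w IH; rewrite star_word_cons word_odd_rcons IH orbC. Qed.

Lemma unzip1_star w : unzip1 (star_word w) = iota 0 (size w).+1.
Proof. by rewrite /= unzip1_zip ?size_iota ?size_rev. Qed.

Lemma unzip2_star w : unzip2 (star_word w) = false :: rev w.
Proof. by rewrite /= unzip2_zip ?size_iota ?size_rev. Qed.

(** The default letter is odd, so that the empty word does not qualify. *)
Definition starts_even (W : word) : bool := head (0%N, true) W == (0%N, false).

Lemma starts_even_rcons W n c : starts_even (rcons W (n.+1, c)) = starts_even W.
Proof. by case: W. Qed.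

(** A commutator with a letter other than that of the mark can begin with the
letter of the mark only through the term that appends the new letter on the
right.  If an R occurs, the letter of the mark is odd in every word. *)
Lemma evP_ad_word w n (p : int) phi : n = (size w).+1 -> p = count id w ->
  (forall W, ~~ starts_even W -> phi W = 0) ->
  evP (ad_word n p w) phi = if has id w then 0 else phi (star_word w).
Proof.
move=> -> ->; elim: w phi => [|c w IH] phi Hphi.
  by rewrite /= (evc_id amalg_words_valid amalg_ev_rel) Hphi ?add0r.
rewrite [size _]/= ad_word_cons; case: c => /=.
  rewrite evP_square (_ : (1 + count id w)%N%:Z - 1 = count id w); last by lia.
  rewrite IH; last first.
    move=> W sW; case: ifP => // _; rewrite !Hphi ?starts_even_rcons //.
    by rewrite /ksign oppr0 if_same addr0.
  by case: ifP => // hw; rewrite word_odd_star hw.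
rewrite evP_angle add0n IH; last first.
  by move=> W sW; rewrite !Hphi ?starts_even_rcons // subr0.
by rewrite star_word_cons (Hphi (((size w).+1, false) :: _)) ?subr0.
Qed.

Lemma evP_degree_neg n (p : int) (x : P n p) phi : p < 0 -> evP x phi = 0.
Proof.
move=> p0; apply: (evc_zero amalg_words_valid) => W /andP[_ /eqP cW]; exfalso.
have : (word_odd W <= count snd W)%N.
  by rewrite /word_odd has_count; case: (count _ _).
rewrite -lez_nat cW; lia.
Qed.

(** By d R = A + L - R d.  The A term contributes no word that begins with the
even letter of the mark and has an odd letter; the L term does exactly if no R
precedes, that is, for the innermost R; the other R are skipped by - R d. *)
Lemma evP_d_ad_word w : exists b : bool,
  forall n (p q : int) (e : q + 1 = p) (phi : word -> int),
  n = (size w).+1 -> p = count id w -> has id w ->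
  (forall W, ~~ (starts_even W && word_odd W) -> phi W = 0) ->
  evP (d e (ad_word n p w)) phi = if b then - phi (star_word w) else phi (star_word w).
Proof.
elim: w => [|c w [b Hb]]; first by exists true.
case: c; last first.
  exists b => n p q e phi -> Ep hw Hphi.
  have f1 : 0 - 1 + p = q by lia.
  rewrite [size _]/= ad_word_cons (d_comp _ _ f1 (add0r q) (erefl : 0 - 1 + 1 = 0 :> int) e).
  rewrite d_angle op_comp0l add0r evP_angle (Hb _ p q e _ erefl Ep hw).
    by rewrite star_word_cons (Hphi (((size w).+1, false) :: _)) // subr0.
  move=> W sW; rewrite !Hphi ?subr0 //.
  by rewrite starts_even_rcons word_odd_rcons orbF.
exists (if has id w then ~~ (b (+) odd `|(count id w)%:Z - 1|%N) else true).
move=> n p q e phi -> Ep _ Hphi; rewrite [size _]/= ad_word_cons.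
have Ep1 : p - 1 = count id w by rewrite Ep /=; lia.
have f1 : 0 + (p - 1) = q by lia.
have f2 : 1 + (p - 1 - 1) = q by lia.
rewrite (d_comp _ _ f1 f2 (erefl : 0 + 1 = 1 :> int) (subrK 1 (p - 1))) d_square.
rewrite op_compDl {1}/ksign /= !(evcD amalg_words_valid amalg_ev_rel)
  (evcN amalg_words_valid amalg_ev_rel).
have star_n V n' c : ~~ starts_even ((n'.+1, c) :: V) by [].
have -> : evP (op_comp (erefl : (2 + (size w).+1 = (size w).+3)%N) f1 ord0 (gen Angle)
    (ad_word (size w).+1 (p - 1) w)) phi = 0.
  rewrite evP_angle evP_ad_word //; last first.
    by move=> W sW; rewrite !Hphi ?subr0 ?starts_even_rcons // (negPf sW).
  case: ifP => // hw; rewrite !Hphi ?subr0 //.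
  by rewrite word_odd_rcons word_odd_star hw andbF.
have -> : evP (op_comp (erefl : (2 + (size w).+1 = (size w).+3)%N) f1 ord0 angle_op
    (ad_word (size w).+1 (p - 1) w)) phi = if has id w then 0 else - phi (star_word (true :: w)).
  rewrite evP_angle_op evP_ad_word //; last first.
    move=> W sW; case: ifP => // _; rewrite !Hphi ?starts_even_rcons ?(negPf sW) //.
  case: ifP => // hw; rewrite word_odd_star hw star_word_cons.
  rewrite (Hphi (_ :: star_word w)) // (Hphi (_ :: star_word w)) //.
  rewrite (Hphi (rcons _ (_, false))) ?subrr ?addr0 ?sub0r //.
  by rewrite word_odd_rcons word_odd_star hw andbF.
rewrite add0r evP_square; case hw: (has id w); last first.
  rewrite evP_degree_neg ?subr0 //.
  by move: hw; rewrite has_count lt0n => /eqP E; rewrite Ep1 E.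
rewrite sub0r (Hb _ _ _ _ _ erefl Ep1 hw); last first.
  move=> W; case: ifP => // oW; rewrite andbT => sW.
  by rewrite !Hphi ?starts_even_rcons ?(negPf sW) // /ksign oppr0 if_same addr0.
rewrite word_odd_star hw star_word_cons Ep1 (Hphi (_ :: star_word w)) // addr0 /ksign.
by case: (b); case: odd => /=; rewrite ?opprK.
Qed.

(** The pairs (s, w) for which w relabelled by s is an operator word of arity n
and degree p with mark j. *)
Definition ad_index n (p : int) (j : 'I_n) (t : 'S_n * seq bool) : bool :=
  [&& (t.1^-1%g j == 0%N :> nat), size t.2 == n.-1 & (count id t.2)%:Z == p].

Definition ad_elt n p (t : 'S_n * seq bool) : P n p := op_act t.1 (ad_word n p t.2).

Definition signed (V : zmodType) (b : bool) (x : V) : V := if b then - x else x.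

Definition ad_span n p (j : 'I_n) (x : P n p) : Prop :=
  exists2 l : seq (bool * ('S_n * seq bool)), all (fun t => ad_index p j t.2) l &
    x = \sum_(t <- l) signed t.1 (ad_elt p t.2).

Lemma ad_span0 n p (j : 'I_n) : ad_span j (0 : P n p).
Proof. by exists [::]; rewrite ?big_nil. Qed.

Lemma ad_spanD n p (j : 'I_n) (x y : P n p) : ad_span j x -> ad_span j y -> ad_span j (x + y).
Proof. by move=> [l hl ->] [l' hl' ->]; exists (l ++ l'); rewrite ?all_cat ?hl // big_cat. Qed.

Lemma ad_spanN n p (j : 'I_n) (x : P n p) : ad_span j x -> ad_span j (- x).
Proof.
move=> [l hl ->]; exists [seq (~~ t.1, t.2) | t <- l]; first by rewrite all_map.
by rewrite big_map -sumrN; apply: eq_bigr => -[[] t] _; rewrite /signed /= ?opprK.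
Qed.

Lemma ad_span_map m p n q (j : 'I_m) (j' : 'I_n) (F : P m p -> P n q) (x : P m p) :
  {morph F : x y / x + y} ->
  (forall t, ad_index p j t -> ad_span j' (F (ad_elt p t))) -> ad_span j x -> ad_span j' (F x).
Proof.
move=> FD Hspan [l hl ->].
have F0 : F 0 = 0 by apply: (addrI (F 0)); rewrite -FD !addr0.
have FN y : F (- y) = - F y by apply: (addrI (F y)); rewrite -FD !subrr F0.
elim: l hl => [_|[b t] l IH /= /andP[ht hl]]; first by rewrite big_nil F0; apply: ad_span0.
rewrite big_cons FD; apply: ad_spanD; last exact: IH.
by case: b; rewrite /signed /= ?FN; [apply: ad_spanN|]; apply: Hspan.
Qed.

Lemma ad_span1 n p (j : 'I_n) t : ad_index p j t -> ad_span j (ad_elt p t).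
Proof. by move=> ht; exists [:: (false, t)]; rewrite ?big_seq1 //= ht. Qed.

Definition is_square (g : amalg_gen) : bool := if g is Square then true else false.

Lemma grown_span n p (j : 'I_n) (x : P n p) : grown j x -> ad_span j x.
Proof.
elim=> {n p j x} [|n p j|n p j x y _ IHx _ IHy|n p j x _ IHx|n p s j j' x Ej _ IHx
  |g n k p r e f j j' x Ej _ IHx].
- have -> : op_id P = ad_elt 0 (1%g : 'S_1, [::]) by rewrite /ad_elt op_act1.
  by apply: ad_span1; rewrite /ad_index /= invg1 perm1.
- exact: ad_span0.
- exact: ad_spanD.
- exact: ad_spanN.
- apply: ad_span_map IHx; first exact: op_actD.
  move=> [s' w] /and3P[h1 h2 h3]; rewrite /ad_elt -op_actM; apply: (ad_span1 (t := (_, _))).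
  by rewrite /ad_index /= invMg permM Ej permK h1 h2.
- apply: (ad_span_map (F := op_comp e f ord0 (gen g))) IHx; first exact: op_compDr.
  move=> [s w] /and3P[/eqP h1 /eqP h2 /eqP h3].
  have [u Hu] := block_perm_exists e ord0 (1%g : 'S_2) s.
  have := op_comp_act e f (gen g) (ad_word n p w) Hu; rewrite perm1 op_act1 /ad_elt => ->.
  destruct n as [|n]; first by case: j {h1 Ej}.
  have Ek : k = n.+2 by lia.
  subst k.
  rewrite (_ : op_comp _ _ _ _ _ = ad_word n.+2 r (is_square g :: w)); last first.
    rewrite ad_word_cons; case: g f => /= f.
      have Er : p = r by rewrite -f add0r.
      case: r / Er f => f.
      by rewrite (eq_irrelevance f (add0r p)) (eq_irrelevance e erefl).
    have Er : r - 1 = p by rewrite -f; lia.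
    by case: p / Er f x h3 => f _ _;
      rewrite (eq_irrelevance f (add1_pred r)) (eq_irrelevance e erefl).
  apply: (ad_span1 (t := (u, is_square g :: w))); rewrite /ad_index /=; apply/and3P; split.
  + have u0 : u ord0 = s ord0 :> nat by rewrite (Hu.1 ord0) // perm1.
    have s0 : s ord0 = j.
      by rewrite (_ : ord0 = s^-1%g j) ?permKV //; apply: val_inj; rewrite /= h1.
    have -> : j' = u ord0 by apply: val_inj; rewrite /= Ej u0 s0.
    by rewrite permK.
  + by rewrite h2.
  + by rewrite -f -h3; case: (g); rewrite /= ?add0r ?PoszD.
Qed.

(** Dual functionals [T u] detect the coefficients of a combination of the
v t. *)
Lemma signed_sum_eq0 (V : zmodType) (I : eqType) (v : I -> V) (l : seq (bool * I))
    (T : I -> I -> int) :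
  (forall u, u \in unzip2 l -> \sum_(t <- l) signed t.1 (T u t.2) = 0) ->
  (forall u t, u \in unzip2 l -> t \in unzip2 l -> t != u -> T u t = 0) ->
  (forall u, u \in unzip2 l -> T u u != 0) ->
  \sum_(t <- l) signed t.1 (v t.2) = 0.
Proof.
move=> sum0 T0 Tn0.
have signedE (X : zmodType) b (x : X) : signed b x = x *~ signed b 1.
  by case: b; rewrite /signed ?mulrN1z ?mulr1z.
transitivity (\sum_(u <- undup (unzip2 l)) \sum_(t <- l | u == t.2) signed t.1 (v t.2)).
  rewrite (exchange_big_dep predT) //=; apply: eq_big_seq => t tl.
  rewrite big_mkcond (bigD1_seq t.2) ?undup_uniq ?mem_undup ?map_f //= eqxx big1 ?addr0 //.
  by move=> u /negPf ->.
rewrite big_seq big1 // => u; rewrite mem_undup => ul.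
transitivity (v u *~ \sum_(t <- l | u == t.2) signed t.1 1).
  by rewrite mulrz_sumr; apply: eq_bigr => t /eqP ->; apply: signedE.
suff -> : \sum_(t <- l | u == t.2) signed t.1 (1 : int) = 0 by rewrite mulr0z.
apply: (mulfI (Tn0 u ul)); rewrite mulr0; apply: etrans (sum0 u ul).
rewrite mulr_sumr [RHS](bigID (fun t => u == t.2)) /=.
rewrite [X in _ = _ + X]big_seq_cond [X in _ = _ + X]big1 ?addr0.
  by apply: eq_bigr => t /eqP <-; rewrite [RHS]signedE -mulrzl mulrzl -mulrzr intz.
move=> t /andP[tl tu]; rewrite (T0 u) ?map_f //; last by rewrite eq_sym.
by rewrite /signed oppr0 if_same.
Qed.

Lemma unzip2_relabel f W : unzip2 (relabel f W) = unzip2 W.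
Proof. by rewrite /unzip2 /relabel -map_comp. Qed.

(** A linear, equivariant evaluation F that sends every operator word to plus
or minus its leading word is injective on the span of the operator words. *)
Lemma grown_eq0 n (p : int) (j : 'I_n) (F : P n p -> (word -> int) -> int) :
  (forall phi x y, F (x + y) phi = F x phi + F y phi) ->
  (forall s x phi, F (op_act s x) phi = F x (fun W => phi (relabel (perm_nat s) W))) ->
  (forall w, size w = n.-1 -> (count id w)%:Z = p -> exists b : bool, forall phi,
    (forall W, ~~ (starts_even W && (word_odd W == has id w)) -> phi W = 0) ->
    F (ad_word n p w) phi = signed b (phi (star_word w))) ->
  forall x, grown j x -> (forall phi, F x phi = 0) -> x = 0.
Proof.
move=> FD Fact Fad x /grown_span[l hl Ex] Fx; rewrite {}Ex in Fx *.
have F0 phi : F 0 phi = 0 by apply: (addrI (F 0 phi)); rewrite -FD !addr0.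
have FN phi y : F (- y) phi = - F y phi by apply: (addrI (F y phi)); rewrite -FD !subrr F0.
have n_gt0 : (0 < n)%N by apply: leq_ltn_trans (ltn_ord j).
have ad0 t : ad_index p j t -> perm_nat t.1 0 = j.
  case/and3P=> /eqP h _ _; rewrite -[0%N]/(val (Ordinal n_gt0)) perm_natE.
  by rewrite (_ : Ordinal n_gt0 = t.1^-1%g j) ?permKV //; apply: val_inj.
pose phi (u : 'S_n * seq bool) (W : word) : int :=
  (W == relabel (perm_nat u.1) (star_word u.2) : nat)%:Z.
have phi_neq0 u W : phi u W != 0 -> W = relabel (perm_nat u.1) (star_word u.2).
  by rewrite /phi; case: (W =P _).
have hidx t : t \in unzip2 l -> ad_index p j t by move/mapP=> [t' /(allP hl) h ->].
have Fval u t : ad_index p j u -> ad_index p j t -> exists b : bool,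
    F (ad_elt p t) (phi u) = signed b (phi u (relabel (perm_nat t.1) (star_word t.2))).
  move=> hu ht; case/and3P: (ht) => _ /eqP sw /eqP cw; have [b Hb] := Fad _ sw cw.
  exists b; rewrite Fact Hb // => W; apply: contraNeq => /phi_neq0 E; apply/andP; split.
    case: W E => [|[z c] W] //= [Ez -> _]; rewrite /starts_even /= xpair_eqE andbT.
    by apply/eqP; apply: (@perm_nat_inj n t.1); rewrite Ez !ad0.
  rewrite -(word_odd_relabel (perm_nat t.1)) E word_odd_relabel word_odd_star !has_count.
  by case/and3P: hu => _ _ /eqP; rewrite -cw => -[->].
apply: (@signed_sum_eq0 _ _ _ _ (fun u t => F (ad_elt p t) (phi u))).
- move=> u _; rewrite -[RHS](Fx (phi u)); elim: (l) => [|t l' IH]; first by rewrite !big_nil F0.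
  by rewrite !big_cons FD IH; case: (t.1); rewrite /signed ?FN.
- move=> u t /hidx hu /hidx ht tu; have [b ->] := Fval u t hu ht.
  suff -> : phi u (relabel (perm_nat t.1) (star_word t.2)) = 0 by rewrite /signed oppr0 if_same.
  apply: contraNeq tu => /phi_neq0 E; apply/eqP.
  have := congr1 unzip2 E; have := congr1 unzip1 E.
  rewrite !unzip1_relabel !unzip2_relabel !unzip1_star !unzip2_star.
  case/and3P: hu => _ /eqP -> _; case/and3P: ht => _ /eqP -> _; rewrite prednK //.
  case: t u {E b} => [s w] [s' w'] /= /eq_in_map Es [Ew]; congr (_, _).
    apply/permP => o; apply: val_inj; rewrite /= -!perm_natE.
    by apply: Es; rewrite mem_iota add0n ltn_ord.
  exact: (can_inj revK).
- move=> u /hidx hu; have [b ->] := Fval u u hu hu; rewrite /phi eqxx /signed.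
  by case: b.
Qed.

(** * The universal property of a presented operad *)

Section Interpretation.
Variables (G : signature) (R : relations G) (O : gradedOperad).
Variable og : forall g : G, O (gen_arity g) (gen_degree g).

Fixpoint interp n p (x : term G n p) : O n p :=
  match x with
  | tgen g => og g
  | tid => op_id O
  | tzero _ _ => 0
  | tadd _ _ x y => interp x + interp y
  | topp _ _ x => - interp x
  | tact _ _ s x => op_act s (interp x)
  | tcomp _ _ _ _ _ _ e f i x y => op_comp e f i (interp x) (interp y)
  end.

Hypothesis interp_rel : forall n p (x y : term G n p), R x y -> interp x = interp y.

Lemma interp_eqv n p (x y : term G n p) : eqv R x y -> interp x = interp y.
Proof.
elim=> {n p x y} //=.
- by move=> n p x y z _ -> _ ->.
- by move=> n p x x' y y' _ -> _ ->.
- by move=> n p x x' _ ->.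
- by move=> n p s x x' _ ->.
- by move=> m n k p q r e f i x x' y y' _ -> _ ->.
- by move=> n p x y z; rewrite addrA.
- by move=> n p x y; rewrite addrC.
- by move=> n p x; rewrite add0r.
- by move=> n p x; rewrite addNr.
- by move=> n p s x y; rewrite op_actD.
- by move=> n p x; rewrite op_act1.
- by move=> n p s t x; rewrite op_actM.
- by move=> m n k p q r e f i x x' y; rewrite op_compDl.
- by move=> m n k p q r e f i x y y'; rewrite op_compDr.
- by move=> n q e f i y; rewrite op_compIl.
- by move=> m p e f i x; rewrite op_compIr.
- by move=> *; apply: op_comp_seq.
- move=> l m n k1 k2 k p q r t1 t2 t e1 f1 e2 f2 e3 f3 e4 f4 i j j' i' x y z ij Ej Ei.
  rewrite (op_comp_par e1 f1 e2 f2 e3 f3 e4 f4 _ _ _ ij Ej Ei) /tsign /ksign.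
  by case: ifP.
- by move=> *; apply: op_comp_act.
Qed.

Definition interp_class n p (x : presented R n p) : O n p :=
  interp (generic_quotient.repr x).

Lemma interp_classE n p (x : term G n p) : interp_class (cls R x) = interp x.
Proof. exact/interp_eqv/repr_eqv. Qed.

End Interpretation.

(** * The morphism to the Lie operad *)

Definition to_lie_gen (g : amalg_sig) : presented lie_rel (gen_arity g) (gen_degree g) :=
  match g with Angle => bracket_op | Square => 0 end.

Lemma bracket_op_anti : op_act transp bracket_op = - bracket_op.
Proof. by rewrite -cls_act -clsN; apply/clsP/eqv_rel/lie_anti. Qed.

Lemma to_lie_rel n p (x y : term amalg_sig n p) : amalg_rel x y ->
  interp to_lie_gen x = interp to_lie_gen y.
Proof.
case=> {n p x y} /=; rewrite ?bracket_op_anti.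
- by rewrite op_act0.
- rewrite !op_compNl !op_compNr !op_actN !opprK.
  have : cls lie_rel (let J := (bracket o_1 bracket)%OT in (J + tau J + tau (tau J))%OT) = 0.
    exact/clsP/eqv_rel/lie_jacobi.
  by rewrite /= /tau /tcomp1 !clsD !cls_act !cls_comp.
- by rewrite !op_comp0l op_comp0r !op_act0; apply: addr0.
- by rewrite op_comp0r.
- by rewrite op_comp0l !op_act0; apply: etrans (addr0 _) (addr0 _).
Qed.

Definition to_lie n p (x : Amalg n p) : Lie n p := interp_class to_lie_gen x.

Lemma to_lieE n p (x : term amalg_sig n p) : to_lie (cls amalg_rel x) = interp to_lie_gen x.
Proof. exact: interp_classE to_lie_rel _ _ _. Qed.

Lemma to_lieD n p (x y : Amalg n p) : to_lie (x + y) = to_lie x + to_lie y.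
Proof. by elim/cls_ind: x => x; elim/cls_ind: y => y; rewrite -clsD !to_lieE. Qed.

Lemma to_lie0 n p : to_lie (0 : Amalg n p) = 0.
Proof. exact: (to_lieE tzero). Qed.

Lemma to_lieN n p (x : Amalg n p) : to_lie (- x) = - to_lie x.
Proof. by elim/cls_ind: x => x; rewrite -clsN !to_lieE. Qed.

Lemma to_lie_sign n p q (x : Amalg n p) : to_lie (ksign q x) = ksign q (to_lie x).
Proof. by rewrite /ksign; case: ifP => // _; apply: to_lieN. Qed.

Lemma to_lie_act n p (s : 'S_n) (x : Amalg n p) : to_lie (op_act s x) = op_act s (to_lie x).
Proof. by elim/cls_ind: x => x; rewrite -cls_act !to_lieE. Qed.

Lemma to_lie_comp m n k p q r (e : (m + n = k.+1)%N) (f : p + q = r) (i : 'I_m)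
    (x : Amalg m p) (y : Amalg n q) :
  to_lie (op_comp e f i x y) = op_comp e f i (to_lie x) (to_lie y).
Proof. by elim/cls_ind: x => x; elim/cls_ind: y => y; rewrite -cls_comp !to_lieE. Qed.

Lemma to_lie_id : to_lie (op_id Amalg) = op_id Lie.
Proof. exact: (to_lieE tid). Qed.

Lemma to_lie_d n (p q : int) (e : q + 1 = p) (x : Amalg n p) : to_lie (dg_d e x) = 0.
Proof.
elim/cls_ind: x => x; rewrite -[dg_d e _]/(pder _ e _) (pderE amalg_der_rel).
elim: x q e => {n p}.
- move=> g q e /=; move: (degree_pred e) => {e} Eq; case: q / Eq; case: g => /=;
    first exact: to_lie0.
  by rewrite to_lieE /= bracket_op_anti; apply: subrr.
- by move=> q e; exact: to_lie0.
- by move=> n p q e; exact: to_lie0.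
- by move=> n p x IHx y IHy q e; rewrite /= to_lieD IHx IHy addr0.
- by move=> n p x IHx q e; rewrite /= to_lieN IHx oppr0.
- by move=> n p s x IHx q e; rewrite /= to_lie_act IHx op_act0.
- move=> m n k p q r e f i x IHx y IHy q' e'; rewrite /= to_lieD to_lie_sign !to_lie_comp.
  by rewrite IHx IHy op_comp0l op_comp0r ksign0 addr0.
Qed.

Definition to_lie_mor : dgOperadMorphism Amalg Lie :=
  @DgOperadMorphism Amalg Lie to_lie to_lieD to_lie_d to_lie_id to_lie_act to_lie_comp.

(** A composite of arity 0 has an inner factor of arity 0, and the generators
and the identity have positive arity. *)
Lemma amalg_arity0 n p (x : Amalg n p) : n = 0%N -> x = 0.
Proof.
elim/cls_ind: x => x; elim: x => {n p} //.
- by move=> n p x IHx y IHy E; rewrite clsD IHx // IHy // addr0.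
- by move=> n p x IHx E; rewrite clsN IHx // oppr0.
- by move=> n p s x IHx E; rewrite cls_act IHx // op_act0.
- move=> m n k p q r e f i x _ y IHy E; rewrite cls_comp IHy ?op_comp0r //.
  by have := ltn_ord i; lia.
Qed.

Lemma evL_ad_word w n phi : n = (size w).+1 -> ~~ has id w ->
  (forall W, ~~ starts_even W -> phi W = 0) ->
  evL (to_lie (ad_word n 0 w)) phi = phi (star_word w).
Proof.
move=> ->; elim: w phi => [|c w IH] phi hw Hphi.
  by rewrite [ad_word _ _ _]/= to_lie_id (evc_id lie_words_valid lie_ev_rel) Hphi ?add0r.
move: hw; rewrite /= negb_or => /andP[/negPf -> hw]; rewrite -/(ad_word _ _ _) to_lie_comp.
have -> : to_lie (gen Angle) = bracket_op by exact: (to_lieE (@tgen amalg_sig Angle)).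
rewrite evL_bracket IH //; last first.
  by move=> W sW; case: ifP => // _; rewrite !Hphi ?starts_even_rcons // subr0.
by rewrite word_odd_star (negPf hw) star_word_cons (Hphi (((size w).+1, false) :: _)) ?subr0.
Qed.

(** The evaluation is that of d x in positive degrees and that of the image in
the Lie operad in degree 0; there are no operator words of negative degree. *)
Lemma grown_exact n (p : int) (j : 'I_n) (x : P n p) : grown j x ->
  (forall q (e : q + 1 = p), d e x = 0) -> to_lie x = 0 -> x = 0.
Proof.
move=> gx dx lx.
case: p x gx dx lx => [[|m]|m] x gx dx lx.
- apply: (grown_eq0 (F := fun y => evL (to_lie y)) _ _ _ gx).
  + by move=> phi y z; rewrite to_lieD (evcD lie_words_valid lie_ev_rel).
  + by move=> s y phi; rewrite to_lie_act (evc_act lie_words_valid lie_ev_rel).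
  + move=> w sw [cw]; exists false => phi Hphi.
    have hw : ~~ has id w by rewrite has_count cw.
    rewrite evL_ad_word ?sw ?prednK //; first exact: leq_ltn_trans (ltn_ord j).
    by move=> W sW; rewrite Hphi // (negPf sW).
  + by move=> phi; rewrite lx (evc0 lie_words_valid lie_ev_rel).
- have e : m%:Z + 1 = m.+1 by lia.
  apply: (grown_eq0 (F := fun y => evP (d e y)) _ _ _ gx).
  + by move=> phi y z; rewrite dD (evcD amalg_words_valid amalg_ev_rel).
  + by move=> s y phi; rewrite d_act (evc_act amalg_words_valid amalg_ev_rel).
  + move=> w sw [cw]; have [b Hb] := evP_d_ad_word w; exists b => phi Hphi.
    have hw : has id w by rewrite has_count cw.
    rewrite Hb ?sw ?prednK ?cw //; first exact: leq_ltn_trans (ltn_ord j).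
    by move=> W sW; rewrite Hphi // hw eqb_id.
  + by move=> phi; rewrite dx (evc0 amalg_words_valid amalg_ev_rel).
- by apply: (grown_eq0 (F := fun _ _ => 0) _ _ _ gx) => // phi; rewrite addr0.
Qed.

(** The Lie operad is generated by the image of the cycle <-,->. *)
Lemma to_lie_surj n p (y : Lie n p) : exists2 x : Amalg n p,
  (forall q (e : q + 1 = p), dg_d e x = 0) & to_lie x = y.
Proof.
elim/cls_ind: y => y; elim: y => {n p}.
- case; exists amalg_angle; first exact: amalg_d_angle.
  exact: (to_lieE (@tgen amalg_sig Angle)).
- exists (op_id Amalg); [exact: dg_d_id|exact: to_lie_id].
- move=> n p; exists 0; [by move=> q e; apply: d0|exact: to_lie0].
- move=> n p y [x dx Ex] y' [x' dx' Ex']; exists (x + x'); last by rewrite clsD to_lieD Ex Ex'.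
  by move=> q e; rewrite dg_dD dx dx' addr0.
- move=> n p y [x dx Ex]; exists (- x); last by rewrite clsN to_lieN Ex.
  by move=> q e; rewrite [LHS]dN -[pder _ _ _]/(dg_d e x) dx oppr0.
- move=> n p s y [x dx Ex]; exists (op_act s x); last by rewrite cls_act to_lie_act Ex.
  by move=> q e; rewrite dg_d_act dx op_act0.
- move=> m n k p q r e f i y [x dx Ex] y' [x' dx' Ex']; exists (op_comp e f i x x').
    move=> t h; have f1 : p - 1 + q = t by lia.
    have f2 : p + (q - 1) = t by lia.
    rewrite (dg_d_comp e f f1 f2 (subrK 1 p) (subrK 1 q) h) dx dx'.
    by rewrite op_comp0l op_comp0r ksign0 addr0.
  by rewrite cls_comp to_lie_comp Ex Ex'.
Qed.

Lemma to_lie_unique (g : dgOperadMorphism Amalg Lie) :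
  mor_fun g amalg_angle = lie_bracket -> mor_fun g amalg_square = 0 ->
  forall n p (x : Amalg n p), mor_fun g x = to_lie x.
Proof.
move=> g_angle g_square n p; elim/cls_ind => x; rewrite to_lieE.
have g0 n' p' : mor_fun g (0 : Amalg n' p') = 0.
  by apply: (addrI (mor_fun g (0 : Amalg n' p'))); rewrite -morD !addr0.
have gN n' p' (z : Amalg n' p') : mor_fun g (- z) = - mor_fun g z.
  by apply: (addrI (mor_fun g z)); rewrite -morD !subrr g0.
elim: x => {n p} /=.
- by case.
- exact: (mor_id g).
- by move=> n p; apply: g0.
- by move=> n p x IHx y IHy; rewrite clsD morD IHx IHy.
- by move=> n p x IHx; rewrite clsN gN IHx.
- by move=> n p s x IHx; rewrite cls_act mor_act IHx.
- by move=> m n k p q r e f i x IHx y IHy; rewrite cls_comp mor_comp IHx IHy.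
Qed.

Lemma to_lie_quasi_iso : operad_quasi_iso to_lie_mor.
Proof.
move=> n p; split=> [x y cx cy [z Ez]|y _]; last first.
  have [x dx Ex] := to_lie_surj y; exists x => //; exists 0.
  by rewrite -[mor_fun _ _]/(to_lie x) Ex subrr.
have [n0|n_gt0] := posnP n.
  by exists 0; rewrite [x]amalg_arity0 // [y]amalg_arity0 // subrr; apply: d0.
pose j := Ordinal n_gt0.
have [u [v [gu gv E]]] := semigrown_all (x - y : P n p) j.
exists v; rewrite -[cx_d _ _]/(d _ v) E (_ : u = 0) ?add0r //.
apply: (grown_exact gu).
  move=> q e; have : d e (x - y : P n p) = 0.
    have -> : d e (x - y : P n p) = dg_d e (x : Amalg n p) - dg_d e (y : Amalg n p).
      by rewrite dD dN.
    by rewrite [dg_d e (x : Amalg n p)]cx [dg_d e (y : Amalg n p)]cy subrr.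
  by rewrite E dD dd addr0.
have : to_lie (x - y : Amalg n p) = 0 by rewrite to_lieD to_lieN; exact: esym Ez.
rewrite E to_lieD => <-.
rewrite -[X in _ + X]/(to_lie (dg_d (erefl (p + 1)) (v : Amalg n (p + 1)))).
by rewrite to_lie_d addr0.
Qed.

Theorem mainTheorem18 :
  exists f : dgOperadMorphism Amalg Lie,
    [/\ mor_fun f amalg_angle = lie_bracket,
        mor_fun f amalg_square = 0,
        (forall g : dgOperadMorphism Amalg Lie,
           mor_fun g amalg_angle = lie_bracket -> mor_fun g amalg_square = 0 ->
           forall (n : nat) (p : int) (x : Amalg n p),
             mor_fun g x = mor_fun f x)
      & operad_quasi_iso f].
Proof.
exists to_lie_mor; split.
- exact: (to_lieE (@tgen amalg_sig Angle)).
- exact: (to_lieE (@tgen amalg_sig Square)).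
- exact: to_lie_unique.
- exact: to_lie_quasi_iso.
Qed.
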